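(* Let $I\in\mathcal I_\lambda$, $i\in\{1,\dots,n-1\}$, and let $\sigma\in S_n$ be such that $\sigma(i)\in I_a$ and $\sigma(i+1)\in I_b$. Then $$W^{\mathrm{ell}}_{\sigma s_{i,i+1},\,I}=W^{\mathrm{ell}}_{\sigma,I}$$ for $a=b$, and $$W^{\mathrm{ell}}_{\sigma s_{i,i+1},\,I}=\mathcal R^{ab}_{ab}\big(z_{\sigma(i)}/z_{\sigma(i+1)},\mu^{(i)}_{\sigma^{-1}(I)}\big)\,W^{\mathrm{ell}}_{\sigma,I}+\mathcal R^{ba}_{ab}\big(z_{\sigma(i)}/z_{\sigma(i+1)},\mu^{(i)}_{\sigma^{-1}(I)}\big)\,W^{\mathrm{ell}}_{\sigma,\,s_{\sigma(i),\sigma(i+1)}(I)}$$ for $a\ne b$.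
   Context: Fix positive integers $n,N$ and $\lambda=(\lambda_1,\dots,\lambda_N)\in\mathbb Z_{\ge0}^N$ with $\sum_k\lambda_k=n$. Put $\lambda^{(k)}=\lambda_1+\dots+\lambda_k$, $\lambda^{\{1\}}=\lambda^{(1)}+\dots+\lambda^{(N-1)}$. $\mathcal I_\lambda$ is the set of ordered partitions $I=(I_1,\dots,I_N)$ of $\{1,\dots,n\}$ with $|I_k|=\lambda_k$; write $\bigcup_{j\le k}I_j=\{i^{(k)}_1<\dots<i^{(k)}_{\lambda^{(k)}}\}$. Permutations act by $\sigma(I)=(\sigma(I_1),\dots,\sigma(I_N))$; $s_{i,j}\in S_n$ is the transposition of $i$ and $j$. Let $p_{I,j}(m)=|I_j\cap\{1,\dots,m-1\}|$ and let $j(I,k,a)$ be the index $j$ with $i^{(k)}_a\in I_j$. Theta function: $\operatorname{Im}\tau>0$, $q=e^{2\pi i\tau}$; for $x=e^{2\pi iu}$, $x^{1/2}=e^{\pi iu}$, $\vartheta(x)=(x^{1/2}-x^{-1/2})\phi(qx)\phi(q/x)$ with $\phi(x)=\prod_{s\ge0}(1-q^sx)$ (functions are considered on the universal cover of the torus of variables, i.e. through logarithms). Elliptic weight functions: variables $t=(t^{(k)}_a)$, $1\le k\le N-1$, $1\le a\le\lambda^{(k)}$; $z=(z_1,\dots,z_n)$ with $t^{(N)}_a=z_a$; $h$; $\mu=(\mu_1,\dots,\mu_N)$. $$W^{\mathrm{ell}}_I(t,z,h,\mu)=\vartheta(h)^{\lambda^{\{1\}}}\operatorname{Sym}_{t^{(1)}}\cdots\operatorname{Sym}_{t^{(N-1)}}\prod_{k=1}^{N-1}\prod_{a=1}^{\lambda^{(k)}}\Big(\prod_{c=1}^{\lambda^{(k+1)}}\psi^{\mathrm{ell}}_{I,k,a,c}(t^{(k+1)}_c/t^{(k)}_a)\prod_{b=a+1}^{\lambda^{(k)}}\frac{\vartheta(ht^{(k)}_b/t^{(k)}_a)}{\vartheta(t^{(k)}_b/t^{(k)}_a)}\Big),$$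 where $\operatorname{Sym}_{t^{(k)}}$ is the sum over all permutations of $t^{(k)}_1,\dots,t^{(k)}_{\lambda^{(k)}}$, and $\psi^{\mathrm{ell}}_{I,k,a,c}(x)$ equals $\vartheta(hx)$ if $i^{(k+1)}_c<i^{(k)}_a$; $\vartheta(x)$ if $i^{(k+1)}_c>i^{(k)}_a$; and $\vartheta(x\,h^{1+p_{I,j}(i^{(k)}_a)-p_{I,k+1}(i^{(k)}_a)}\mu_{k+1}/\mu_j)\big/\vartheta(h^{1+p_{I,j}(i^{(k)}_a)-p_{I,k+1}(i^{(k)}_a)}\mu_{k+1}/\mu_j)$ with $j=j(I,k,a)$ if $i^{(k+1)}_c=i^{(k)}_a$. For $\sigma\in S_n$, $$W^{\mathrm{ell}}_{\sigma,I}(t,z,h,\mu)=W^{\mathrm{ell}}_{\sigma^{-1}(I)}(t,z_{\sigma(1)},\dots,z_{\sigma(n)},h,\mu).$$ Dynamical shift: $\mu^{(i)}_I=(h^{-p_{I,1}(i)}\mu_1,\dots,h^{-p_{I,N}(i)}\mu_N)$. Elliptic dynamical $R$-matrix entries: $$\mathcal R^{jk}_{kj}(x,\mu)=\frac{\vartheta(x\mu_j/\mu_k)\vartheta(h)}{\vartheta(xh)\vartheta(\mu_j/\mu_k)}\quad(j\ne k),$$ $$\mathcal R^{jk}_{jk}(x,\mu)=\frac{\vartheta(x)\vartheta(h\mu_j/\mu_k)\vartheta(h\mu_k/\mu_j)}{\vartheta(xh)\vartheta(\mu_j/\mu_k)\vartheta(\mu_k/\mu_j)},\qquad\mathcal R^{kj}_{kj}(x,\mu)=\frac{\vartheta(x)}{\vartheta(xh)}\quad(j<k).$$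 *)

(* Defs.v *)
From HB Require Import structures.
From mathcomp Require Import all_boot all_order all_algebra all_fingroup.
From mathcomp Require Import all_classical all_reals all_analysis.
From mathcomp Require Import complex.

Set Implicit Arguments.
Unset Strict Implicit.
Unset Printing Implicit Defensive.

Import Order.TTheory GRing.Theory Num.Theory numFieldNormedType.Exports.
Local Open Scope ring_scope.
Local Open Scope complex_scope.

(** Multiplicative variables are represented by logarithms: a point of the
    universal cover over [x = e^(2 pi i u)] is the complex number [u], so that
    products, quotients and powers of variables become sums, differences and
    multiples.  The arguments called [t], [z], [h], [mu], [x] below are all
    such logarithms. *)

Section Theta.
Context {R : realType}.
Implicit Types (w u x q tau : R[i]).

Definition cexp w : R[i] :=
  (expR (complex.Re w))%:C * (cos (complex.Im w) +i* sin (complex.Im w)).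

Definition qphi q x : R[i] :=
  lim (((fun m : nat => \prod_(0 <= s < m) (1 - q ^+ s * x)) : nat -> R[i]^o)
         @ \oo)%classic.

Definition theta tau u : R[i] :=
  let q := cexp ((0 +i* (2 * pi)) * tau) in
  let x := cexp ((0 +i* (2 * pi)) * u) in
  (cexp ((0 +i* pi) * u) - cexp (- ((0 +i* pi) * u)))
    * qphi q (q * x) * qphi q (q / x).

End Theta.

(** The set [{1, ..., n}] is ['I_n], hence shifted by one; likewise the blocks
    [I_1, ..., I_N], their sizes [lambda_j], the parameters [mu_1, ..., mu_N] and
    the positions [a] inside a group of variables are numbered from 0.  The *level* [k] of
    [lambda^(k)], [i^(k)_a] and [t^(k)_a] is not shifted: it is the number of
    blocks that are joined.  Consequently the level [k] with [1 <= k <= N - 1]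
    can be taken in ['I_N], and the block [I_(k+1)] and the parameter [mu_(k+1)]
    of the usual numbering are [I k] and [mu k]. *)

Section OrderedPartitions.
Context {n N : nat}.
Implicit Types (lam : 'I_N -> nat) (I : 'I_N -> {set 'I_n}).

Definition ordered_partition lam I : Prop :=
  [/\ forall j, #|I j| = lam j,
      forall j k, j != k -> [disjoint I j & I k]
    & \bigcup_(j < N) I j = [set: 'I_n] ].

Definition perm_partition (s : 'S_n) I : 'I_N -> {set 'I_n} :=
  fun j => s @: I j.

Definition lam_upto lam (k : nat) : nat := (\sum_(j < N | j < k) lam j)%N.

(** [elt I k a] is [i^(k)_a]: [enum] lists a subset of ['I_n] increasingly. *)
Definition elt I (k a : nat) : nat :=
  nth 0%N [seq val i | i in \bigcup_(j < N | (j < k)%N) I j] a.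

Definition pcount I (j : 'I_N) (m : nat) : nat := #|[set i in I j | (i < m)%N]|.

(** The index [j(I,k,a)]; the default value [k] is not used when [I] is an
    ordered partition and [a] is a position of level [k]. *)
Definition block_of I (k : 'I_N) (a : nat) : 'I_N :=
  odflt k [pick j | elt I k a \in [seq val i | i in I j]].

End OrderedPartitions.

Section EllipticWeightFunctions.
Context {R : realType} {n N : nat}.
Variables (tau : R[i]) (lam : 'I_N -> nat).
Implicit Types (I : 'I_N -> {set 'I_n}) (t : nat -> nat -> R[i]).
Implicit Types (z : 'I_n -> R[i]) (h x : R[i]) (mu : 'I_N -> R[i]).

(** Logarithm of [h^(1 + p_{I,j}(m) - p_{I,k+1}(m)) mu_(k+1) / mu_j], for
    [m = i^(k)_a] and [j = j(I,k,a)]. *)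
Definition psi_shift I (k : 'I_N) (a : nat) h mu : R[i] :=
  let m := elt I k a in
  let j := block_of I k a in
  h *~ (1 + (pcount I j m)%:Z - (pcount I k m)%:Z) + mu k - mu j.

Definition psi_ell I (k : 'I_N) (a c : nat) h mu x : R[i] :=
  if (elt I k.+1 c < elt I k a)%N then theta tau (h + x)
  else if (elt I k a < elt I k.+1 c)%N then theta tau x
  else theta tau (x + psi_shift I k a h mu) / theta tau (psi_shift I k a h mu).

(** [t k a] is [t^(k)_a]; only the values with [1 <= k <= N - 1] and
    [a < lam_upto lam k] matter.  [with_top t z] sets [t^(N) := z]. *)
Definition with_top t z : nat -> nat -> R[i] :=
  fun k a => if k == N then oapp z 0 (insub a) else t k a.

Definition perm_level (k m : nat) (s : 'S_m) t : nat -> nat -> R[i] :=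
  fun l a =>
    if l == k then oapp (fun i : 'I_m => t k (s i)) (t k a) (insub a) else t l a.

Definition symt (k : nat) (F : (nat -> nat -> R[i]) -> R[i]) t : R[i] :=
  \sum_(s : 'S_(lam_upto lam k)) F (perm_level k s t).

Definition U_ell I h mu t : R[i] :=
  \prod_(k < N | (0 < k)%N) \prod_(a < lam_upto lam k)
    ((\prod_(c < lam_upto lam k.+1) psi_ell I k a c h mu (t k.+1 c - t k a)) *
     \prod_(b < lam_upto lam k | (a < b)%N)
        (theta tau (h + t k b - t k a) / theta tau (t k b - t k a))).

(** The [foldr] is [Sym_{t^(1)} (... (Sym_{t^(N-1)} _))]. *)
Definition W_ell I t z h mu : R[i] :=
  theta tau h ^+ (\sum_(k < N | (0 < k)%N) lam_upto lam k)%N *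
  foldr symt (fun t' => U_ell I h mu (with_top t' z)) (iota 1 N.-1) t.

Definition Wperm_ell (s : 'S_n) I t z h mu : R[i] :=
  W_ell (perm_partition s^-1%g I) t (z \o s) h mu.

(** The weight functions are meromorphic; [W_regular] says that no denominator
    in the formula for [W_ell I] vanishes at the given point.  (The
    denominators do not involve [z].) *)
Definition W_regular I t h mu : Prop :=
  (forall (k : 'I_N) (a b : 'I_(lam_upto lam k)), (0 < k)%N -> a != b ->
     theta tau (t k b - t k a) != 0) /\
  (forall (k : 'I_N) (a : 'I_(lam_upto lam k)), (0 < k)%N ->
     theta tau (psi_shift I k a h mu) != 0).

Definition Wperm_regular (s : 'S_n) I t h mu : Prop :=
  W_regular (perm_partition s^-1%g I) t h mu.

Definition mu_shift I (i : 'I_n) h mu : 'I_N -> R[i] :=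
  fun j => mu j - h *+ pcount I j i.

(** [R_offdiag j k] is the entry with upper indices [jk] and lower indices
    [kj], for [j <> k]; [R_diag j k] is the one with upper and lower indices
    [jk], for [j <> k]. *)
Definition R_offdiag (j k : 'I_N) h x mu : R[i] :=
  theta tau (x + mu j - mu k) * theta tau h /
  (theta tau (x + h) * theta tau (mu j - mu k)).

Definition R_diag (j k : 'I_N) h x mu : R[i] :=
  if (j < k)%N then
    theta tau x * theta tau (h + mu j - mu k) * theta tau (h + mu k - mu j) /
    (theta tau (x + h) * theta tau (mu j - mu k) * theta tau (mu k - mu j))
  else theta tau x / theta tau (x + h).

Definition R_regular (j k : 'I_N) h x mu : Prop :=
  [/\ theta tau (x + h) != 0, theta tau (mu j - mu k) != 0
    & theta tau (mu k - mu j) != 0].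

End EllipticWeightFunctions.

(* Main.v *)
Require Import Defs.
From HB Require Import structures.
From mathcomp Require Import all_boot all_order all_algebra all_fingroup.
From mathcomp Require Import all_classical all_reals all_analysis.
From mathcomp Require Import complex.
From mathcomp Require Import ring lra zify.

Set Implicit Arguments.
Unset Strict Implicit.
Unset Printing Implicit Defensive.

Import Order.TTheory GRing.Theory Num.Theory numFieldNormedType.Exports.
Local Open Scope ring_scope.
Local Open Scope complex_scope.

(** Proof idea.  After replacing [I] by [J = sigma^-1 (I)], only the elements
    [i] and [i + 1] matter: [W_J] is built level by level, level [k + 1] being
    the symmetrization over [t^(k)] of the level-[k] function times an explicit
    product, and every factor of that product not involving both [i] and
    [i + 1] is invariant under the transposition [s] of [i] and [i + 1].  So it
    is enough to show that the exchange relation, multiplied by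
    [theta (x + h)] to avoid denominators at intermediate points, is created at
    the first level that contains both [i] and [i + 1], and that it propagates
    upwards.  Pairing each permutation [p] of [t^(k)] with its product with the
    transposition of the two positions turns both claims into theta identities
    in at most four variables, which follow from oddness and Weierstrass'
    three-term relation.

    The three-term relation comes from the Jacobi triple product: it gives
    [theta (u + v) theta (u - v) = F(u) G(v) - G(u) F(v)] up to a constant,
    whence the three-term relation is the Pluecker relation for 2 x 2 minors.
    [F] and [G] are handled through partial sums only. *)

(** * Limits in the complex numbers *)

Local Notation "u ~> l" := (((u : nat -> _^o) @ \oo --> (l : _^o))%classic)
  (at level 70, only parsing).

(** The exchange relation is directional: it writes the function of [s (J)] with two variables
    interchanged through the functions of [J] and of [s (J)]. In the inductive step both functions
    occur with interchanged variables, so the relation for [J] and the one for [s (J)] are carried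
    together. The R-matrix is normalized asymmetrically: the diagonal coefficient is [cc] in one
    direction and 1 in the other. The step needs only that the two relations are compatible when
    applied in succession, that is [c c' theta(D)^2 = - theta(h + D) theta(h - D)]. The blocks may
    then be taken with [a < b]: the other order is the second relation, for [s (J)] in the role of
    [J].

    Regularity is assumed at the given point only. This suffices for the denominators of the weight
    functions, because the sums only permute the [t^(k)_a] within a level and the dynamical shifts
    do not depend on [t]; but nothing is known about [theta (x + h)] at intermediate levels.

    Adjacency of [i] and [i + 1] enters through the order alone: no third element lies between
    them. *)

Section ComplexLimits.
Context {R : realType}.
Notation C := R[i].
Notation nm := (@ComplexField.Normc.normc R).
Implicit Types (u v : nat -> C) (l : C).

Lemma normE (x : C) : `|x| = (nm x)%:C.
Proof. by []. Qed.

Lemma nm_ge0 (x : C) : 0 <= nm x.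
Proof. by rewrite -lecR -normE normr_ge0. Qed.

(** In the partial order of [R[i]] a positive number is real, so complex radii reduce to real
    ones. *)
Lemma cvgCP u l : (forall e : R, 0 < e -> exists n0, forall n, (n0 <= n)%N ->
  nm (l - u n) < e) -> u ~> l.
Proof.
move=> H; apply/cvgrPdist_lt => e e0.
have eE : e = (complex.Re e)%:C by rewrite RRe_real // gtr0_real.
have /H[n0 Hn] : 0 < complex.Re e by rewrite -ltcR -eE.
exists n0 => // n /= n0n; by rewrite eE normE ltcR Hn.
Qed.

Lemma cvgC_bound u l (v : nat -> R) : (forall n, nm (l - u n) <= v n) ->
  (v @ \oo --> (0 : R))%classic -> u ~> l.
Proof.
move=> H /cvgrPdist_lt v0; apply: cvgCP => e /v0[n0 _ Hn].
exists n0 => n n0n; apply: le_lt_trans (H n) _.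
by have /= := Hn n n0n; rewrite sub0r normrN; apply: le_lt_trans (ler_norm _).
Qed.

Lemma cvgC_lim u l : u ~> l -> lim ((u : nat -> C^o) @ \oo)%classic = l.
Proof. by apply: cvg_lim; exact: norm_hausdorff. Qed.

Lemma cvgC_unique u l l' : u ~> l -> u ~> l' -> l = l'.
Proof. by move=> /cvgC_lim <- /cvgC_lim <-. Qed.

Lemma cvgCD u v l l' : u ~> l -> v ~> l' -> (fun n => u n + v n) ~> l + l'.
Proof. exact: cvgD. Qed.

Lemma cvgCB u v l l' : u ~> l -> v ~> l' -> (fun n => u n - v n) ~> l - l'.
Proof. exact: cvgB. Qed.

Lemma cvgCM u v l l' : u ~> l -> v ~> l' -> (fun n => u n * v n) ~> l * l'.
Proof. exact: cvgM. Qed.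

Lemma cvgC_cst l : (fun=> l) ~> l.
Proof. exact: cvg_cst. Qed.

(** With [K (1 - r) = B], subtracting or adding [K r^n] absorbs the steps and makes the sequence
    nondecreasing or nonincreasing. The limit of the lower sequence lies between the two, which
    gives the rate together with the limit. *)
Lemma geometric_cauchy_real (a : nat -> R) (B r : R) : 0 <= r < 1 ->
  (forall n, `|a n.+1 - a n| <= B * r ^+ n) ->
  exists l : R, forall n, `|l - a n| <= B / (1 - r) * r ^+ n.
Proof.
move=> /andP[r0 r1] Ha; set K := B / (1 - r).
have KE : B = K * (1 - r) by rewrite /K divfK // subr_eq0 eq_sym lt_eqF.
have B0 : 0 <= B by have := Ha 0%N; rewrite expr0 mulr1; apply: le_trans.
have K0 : 0 <= K by rewrite divr_ge0 // subr_ge0 ltW.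
have Kr n : 0 <= K * r ^+ n by rewrite mulr_ge0 // exprn_ge0.
pose b n := a n - K * r ^+ n; pose c n := a n + K * r ^+ n.
have bS : nondecreasing_seq b.
  apply/nondecreasing_seqP => n; have := Ha n; rewrite ler_norml => /andP[h _].
  by rewrite /b exprS; rewrite KE in h; lra.
have cS : nonincreasing_seq c.
  apply/nonincreasing_seqP => n; have := Ha n; rewrite ler_norml => /andP[_ h].
  by rewrite /c exprS; rewrite KE in h; lra.
have bc m n : b m <= c n.
  have h1 := bS m (maxn m n) (leq_maxl _ _).
  have h2 := cS n (maxn m n) (leq_maxr _ _).
  by have := Kr (maxn m n); rewrite /b /c in h1 h2 *; lra.
have bcv : cvgn b by apply: nondecreasing_is_cvgn => //; exists (c 0%N) => _ [m _ <-].
have lb n : b n <= limn b by exact: nondecreasing_cvgn_le.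
have lc n : limn b <= c n by apply: limr_le => //; exact: nearW (bc^~ n).
exists (limn b) => n; move: (lb n) (lc n); move: (limn b) => l.
by rewrite /b /c ler_norml => h1 h2; apply/andP; split; lra.
Qed.

Lemma nm_ReIm (x : C) : nm x <= `|complex.Re x| + `|complex.Im x|.
Proof.
case: x => x y; rewrite /ComplexField.Normc.normc.
rewrite -(@ler_pXn2r _ 2) ?nnegrE ?sqrtr_ge0 ?addr_ge0 //.
rewrite sqr_sqrtr ?addr_ge0 ?sqr_ge0 // sqrrD !real_normK ?num_real //=.
have: 0 <= `|x| * `|y| by rewrite mulr_ge0.
rewrite mulr2n; lra.
Qed.

Lemma Re_le_nm (x : C) : `|complex.Re x| <= nm x.
Proof. by rewrite -lecR -normE normc_ge_Re. Qed.

Lemma Im_le_nm (x : C) : `|complex.Im x| <= nm x.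
Proof.
case: x => x y /=; rewrite -sqrtr_sqr ler_sqrt ?addr_ge0 ?sqr_ge0 //.
by rewrite lerDr sqr_ge0.
Qed.

Lemma ReB (x y : C) : complex.Re (x - y) = complex.Re x - complex.Re y.
Proof. by case: x y => [a b] [c d]. Qed.

Lemma ImB (x y : C) : complex.Im (x - y) = complex.Im x - complex.Im y.
Proof. by case: x y => [a b] [c d]. Qed.

Lemma geometric_cauchy u (B r : R) : 0 <= r < 1 ->
  (forall n, nm (u n.+1 - u n) <= B * r ^+ n) ->
  exists l, forall n, nm (l - u n) <= 2 * B / (1 - r) * r ^+ n.
Proof.
move=> r01 Hu.
have [n|x Hx] := @geometric_cauchy_real (fun n => complex.Re (u n)) B r r01.
  by apply: le_trans (Hu n); rewrite -ReB; exact: Re_le_nm.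
have [n|y Hy] := @geometric_cauchy_real (fun n => complex.Im (u n)) B r r01.
  by apply: le_trans (Hu n); rewrite -ImB; exact: Im_le_nm.
exists (x +i* y) => n; apply: le_trans (nm_ReIm _) _; rewrite ReB ImB /=.
by apply: le_trans (lerD (Hx n) (Hy n)) _; rewrite -mulr2n -[leLHS]mulr_natl !mulrA lexx.
Qed.

End ComplexLimits.

(** * Finite and infinite q-Pochhammer products *)

Section QPochhammer.
Context {R : realType}.
Notation C := R[i].
Notation nm := (@ComplexField.Normc.normc R).
Notation nmM := ComplexField.Normc.normcM.
Notation nmV := ComplexField.Normc.normcV.

Lemma nmD (x y : C) : nm (x + y) <= nm x + nm y.
Proof. exact: le_normcD. Qed.

Lemma nmN (x : C) : nm (- x) = nm x.
Proof. exact: normcN. Qed.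

Lemma nmX (x : C) n : nm (x ^+ n) = nm x ^+ n.
Proof. by elim: n => [|n IH]; rewrite ?exprS ?nmM ?IH // ComplexField.Normc.normc1. Qed.

Lemma nmB (x y : C) : nm (x - y) <= nm x + nm y.
Proof. by rewrite -(nmN y) nmD. Qed.

Lemma nm_eq0 (x : C) : (nm x == 0) = (x == 0).
Proof.
apply/eqP/eqP => [|->]; last exact: ComplexField.Normc.normc0.
exact: ComplexField.Normc.eq0_normc.
Qed.

(** [1 + x <= exp x] and the geometric series. A recursive inequality is used rather than a product,
    so that the bound serves both the products [qpoch] and the reciprocals of [qfact]. *)
Lemma prod_1D_geometric_bound (w : nat -> R) (Y r : R) : 0 <= Y -> 0 <= r < 1 ->
  w 0%N <= 1 -> (forall n, w n.+1 <= w n * (1 + Y * r ^+ n)) ->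
  forall n, w n <= expR (Y / (1 - r)).
Proof.
move=> Y0 /andP[r0 r1] w0 wS n.
have r1' : 0 < 1 - r by rewrite subr_gt0.
have rn k : 0 <= r ^+ k by rewrite exprn_ge0.
suff H : w n <= expR (Y * ((1 - r ^+ n) / (1 - r))).
  apply: le_trans H _; rewrite ler_expR ler_wpM2l //.
  by rewrite ler_pdivrMr // mulVf ?gt_eqF // gerBl.
elim: n => [|n IH]; first by rewrite expr0 subrr mul0r mulr0 expR0.
have -> : Y * ((1 - r ^+ n.+1) / (1 - r)) =
          Y * ((1 - r ^+ n) / (1 - r)) + Y * r ^+ n.
  by rewrite exprS; field; rewrite gt_eqF.
rewrite expRD; apply: le_trans (wS n) _.
apply: le_trans (_ : expR (Y * ((1 - r ^+ n) / (1 - r))) * (1 + Y * r ^+ n) <= _).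
  by rewrite ler_wpM2r // addr_ge0 // mulr_ge0.
by rewrite ler_wpM2l ?expR_ge0 // expR_ge1Dx.
Qed.

Definition qpoch (q x : C) n := \prod_(0 <= s < n) (1 - q ^+ s * x).

Lemma qpoch0 q x : qpoch q x 0 = 1.
Proof. by rewrite /qpoch big_geq. Qed.

Lemma qpochS q x n : qpoch q x n.+1 = qpoch q x n * (1 - q ^+ n * x).
Proof. by rewrite /qpoch big_nat_recr. Qed.

Context (q : C) (q1 : nm q < 1).

Let q01 : 0 <= nm q < 1. Proof. by rewrite nm_ge0. Qed.

Lemma qpoch_bound x n : nm (qpoch q x n) <= expR (nm x / (1 - nm q)).
Proof.
move: n; apply: prod_1D_geometric_bound => //; first exact: nm_ge0.
  by rewrite qpoch0 ComplexField.Normc.normc1.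
move=> n; rewrite qpochS nmM ler_wpM2l ?nm_ge0 //.
by apply: le_trans (nmB _ _) _; rewrite nmM nmX ComplexField.Normc.normc1 mulrC.
Qed.

Lemma qpoch_cauchy x : exists l, exists K, forall n,
  nm (l - qpoch q x n) <= K * nm q ^+ n.
Proof.
set B := expR (nm x / (1 - nm q)) * nm x.
have [n|l Hl] := @geometric_cauchy _ (qpoch q x) B _ q01.
  rewrite qpochS mulrBr mulr1 addrAC subrr sub0r nmN !nmM nmX /B -mulrA.
  rewrite [nm x * nm q ^+ _]mulrC ler_wpM2r ?mulr_ge0 ?exprn_ge0 ?nm_ge0 //.
  exact: qpoch_bound.
by exists l, (2 * B / (1 - nm q)).
Qed.

Lemma cvg_nm_geometric (K : R) : ((fun n => K * nm q ^+ n) @ \oo --> (0 : R))%classic.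
Proof. by apply: cvg_geometric; rewrite ger0_norm ?nm_ge0. Qed.

Lemma cvg_qphi x : qpoch q x ~> qphi q x.
Proof.
have [l [K Hl]] := qpoch_cauchy x.
have cl : qpoch q x ~> l by apply: cvgC_bound Hl _; exact: cvg_nm_geometric.
by rewrite /qphi (cvgC_lim cl).
Qed.

Definition qfact n := qpoch q q n.

(** Puts the reciprocal of a factor in the form [1 + Y r^n] that [prod_1D_geometric_bound]
    requires. *)
Lemma sub1_expr_bound n : nm (1 - q ^+ n.+1)^-1 <= 1 + (1 - nm q)^-1 * nm q ^+ n.
Proof.
have [/andP[r0 r1]] := q01; set r := nm q in r0 r1 *.
have r1' : 0 < 1 - r by rewrite subr_gt0.
have rn k : 0 <= r ^+ k by rewrite exprn_ge0.
have rn1 : r ^+ n <= 1 by rewrite exprn_ile1 // ltW.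
have e1 : r ^+ n.+1 <= r by rewrite exprS ler_piMr.
have h1 : 1 - r ^+ n.+1 <= nm (1 - q ^+ n.+1).
  have := nmD (1 - q ^+ n.+1) (q ^+ n.+1).
  by rewrite subrK ComplexField.Normc.normc1 nmX -/r; lra.
have p1 : 0 < 1 - r ^+ n.+1 by lra.
rewrite nmV; apply: le_trans (_ : (1 - r ^+ n.+1)^-1 <= _).
  by rewrite lef_pV2 ?posrE //; apply: lt_le_trans h1.
rewrite -[leLHS]mul1r ler_pdivrMr // mulrDl mul1r.
have : r ^+ n.+1 <= (1 - r)^-1 * r ^+ n * (1 - r ^+ n.+1).
  apply: le_trans (_ : r ^+ n <= _); first by rewrite exprS ler_piMl // ltW.
  rewrite mulrAC -[leLHS]mul1r ler_wpM2r // -ler_pdivrMl ?invr_gt0 //.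
  by rewrite invrK mulr1; lra.
lra.
Qed.

Lemma qfact_inv_bound n : nm (qfact n)^-1 <= expR ((1 - nm q)^-1 / (1 - nm q)).
Proof.
move: n; apply: prod_1D_geometric_bound => //.
- by rewrite invr_ge0 subr_ge0 ltW.
- by rewrite /qfact qpoch0 invr1 ComplexField.Normc.normc1.
move=> n; rewrite /qfact qpochS invfM nmM ler_wpM2l ?nm_ge0 //.
by rewrite -exprSr; exact: sub1_expr_bound.
Qed.

Lemma qfact_neq0 n : qfact n != 0.
Proof.
have [/andP[r0 r1]] := q01.
rewrite /qfact /qpoch prodf_seq_neq0; apply/allP => s _ /=.
rewrite -exprSr subr_eq0; apply/eqP => e.
have : nm (q ^+ s.+1) < 1 by rewrite nmX exprn_ilt1.
by rewrite -e ComplexField.Normc.normc1 ltxx.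
Qed.

(** Nonzero factors alone do not prevent an infinite product from vanishing. Here the reciprocals of
    the partial products are bounded by [E], so the partial products stay at distance at least
    [1 / E] from 0. *)
Lemma qphi_qq_neq0 : qphi q q != 0.
Proof.
have [l [K Hl]] := qpoch_cauchy q.
have cl : qpoch q q ~> l by apply: cvgC_bound Hl _; exact: cvg_nm_geometric.
have -> : qphi q q = l by rewrite (cvgC_unique cl (@cvg_qphi q)).
apply/eqP => l0; move: cl; rewrite l0.
set E := expR ((1 - nm q)^-1 / (1 - nm q)).
have E0 : 0 < E by exact: expR_gt0.
have e0 : (0 : C) < (E^-1)%:C by rewrite ltcR invr_gt0.
move=> /cvgrPdist_lt /(_ _ e0) [n _ /(_ n (leqnn n))] /=.
rewrite sub0r normrN normE ltcR ltNge => /negP; apply.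
rewrite -[leRHS]invrK lef_pV2 ?posrE ?invr_gt0 //; last first.
  by rewrite lt_neqAle eq_sym nm_eq0 qfact_neq0 nm_ge0.
by rewrite -nmV qfact_inv_bound.
Qed.

End QPochhammer.

(** * The Jacobi triple product *)

Section ComplexExponential.
Context {R : realType}.
Notation C := R[i].
Notation nm := (@ComplexField.Normc.normc R).

Lemma cexpD (v w : C) : cexp (v + w) = cexp v * cexp w.
Proof.
case: v w => [a b] [c d]; rewrite /cexp /= expRD cosD sinD.
by apply/eqP; rewrite eq_complex /=; apply/andP; split; apply/eqP; ring.
Qed.

Lemma cexp0 : cexp (0 : C) = 1.
Proof.
rewrite /cexp /= expR0 cos0 sin0.
by apply/eqP; rewrite eq_complex /=; apply/andP; split; apply/eqP; ring.
Qed.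

Lemma nm_cexp (w : C) : nm (cexp w) = expR (complex.Re w).
Proof.
rewrite /cexp ComplexField.Normc.normcM /= cos2Dsin2 sqrtr1 mulr1.
by rewrite expr0n /= addr0 sqrtr_sqr ger0_norm // expR_ge0.
Qed.

Lemma cexp_neq0 (w : C) : cexp w != 0.
Proof. by rewrite -nm_eq0 nm_cexp expR_eq0. Qed.

Lemma cexpN (w : C) : cexp (- w) = (cexp w)^-1.
Proof.
apply: (mulIf (cexp_neq0 w)); rewrite mulVf ?cexp_neq0 //.
by rewrite -cexpD addNr cexp0.
Qed.

Lemma cexpMn (w : C) n : cexp (n%:R * w) = cexp w ^+ n.
Proof.
elim: n => [|n IH]; first by rewrite mul0r cexp0.
by rewrite -natr1 mulrDl mul1r cexpD IH exprSr.
Qed.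

Definition ipi : C := 0 +i* pi.

Lemma ipi2E : 0 +i* (2 * pi) = 2 * ipi.
Proof. by apply/eqP; rewrite eq_complex /=; apply/andP; split; apply/eqP; ring. Qed.

Lemma cexp_ipi : cexp ipi = -1.
Proof.
rewrite /cexp /= expR0 cospi sinpi.
by apply/eqP; rewrite eq_complex /=; apply/andP; split; apply/eqP; ring.
Qed.

End ComplexExponential.

Section TripleProduct.
Context {R : realType}.
Notation C := R[i].
Notation nm := (@ComplexField.Normc.normc R).

(** The Gaussian binomial coefficient, meaningful for [k <= n]. As a quotient of q-factorials it
    visibly tends to [1 / qphi q q] when [k] and [n - k] both grow. *)
Definition gbin (q : C) n k := qfact q n / (qfact q k * qfact q (n - k)).

(** The upper index is written [k + d.+1] to keep truncated subtraction out of the statement. *)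
Lemma gbin_pascal q k d : nm q < 1 ->
  gbin q (k + d.+1).+1 k.+1 =
  gbin q (k + d.+1) k.+1 + q ^+ d.+1 * gbin q (k + d.+1) k.
Proof.
move=> q1; rewrite /gbin.
have -> : ((k + d.+1).+1 - k.+1 = d.+1)%N by lia.
have -> : ((k + d.+1) - k.+1 = d)%N by lia.
have -> : ((k + d.+1) - k = d.+1)%N by lia.
have := qfact_neq0 q1 k.+1; have := qfact_neq0 q1 d.+1.
rewrite /qfact !qpochS -!exprSr addnS.
have -> : q ^+ (k + d).+2 = q ^+ d.+1 * q ^+ k.+1.
  by rewrite -exprD; congr (_ ^+ _); lia.
have := qfact_neq0 q1 k; have := qfact_neq0 q1 d; rewrite /qfact.
rewrite !mulf_eq0 !negb_or => d0 k0 /andP[_ d1] /andP[_ k1].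
move: (q ^+ d.+1) (q ^+ k.+1) d1 k1 => a b d1 k1.
by field; rewrite d0 k0 d1 k1.
Qed.

(** The finite q-binomial theorem, by the q-Pascal rule. The two extreme terms are split off because
    the rule covers inner indices only. *)
Lemma rothe q y n : nm q < 1 ->
  qpoch q (- y) n = \sum_(0 <= k < n.+1) gbin q n k * (q ^+ 'C(k, 2) * y ^+ k).
Proof.
move=> q1.
have g0 m : gbin q m 0 = 1.
  by rewrite /gbin subn0 {2}/qfact qpoch0 mul1r divff // qfact_neq0.
have gn m : gbin q m m = 1.
  by rewrite /gbin subnn {3}/qfact qpoch0 mulr1 divff // qfact_neq0.
pose c m k := gbin q m k * (q ^+ 'C(k, 2) * y ^+ k).
elim: n => [|n IH]; first by rewrite qpoch0 big_nat1 g0 !expr0 !mulr1.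
rewrite qpochS mulrN opprK mulrDr mulr1 {2}IH {}IH -/(c n).
have -> : \sum_(0 <= k < n.+2) c n.+1 k =
    c n.+1 0%N + (\sum_(0 <= k < n) c n.+1 k.+1 + c n.+1 n.+1).
  by rewrite big_nat_recl // big_nat_recr.
rewrite [X in X + _ = _]big_nat_recl // [X in _ + X * _ = _]big_nat_recr //=.
have -> : c n.+1 0%N = c n 0%N by rewrite /c !g0.
rewrite -addrA; congr (_ + _); rewrite mulrDl addrA mulr_suml -big_split /=.
congr (_ + _); last by rewrite /c !gn binS bin1 exprD exprSr; ring.
apply: eq_big_nat => k /andP[_ kn]; rewrite /c.
have -> : n = (k + (n - k.+1).+1)%N by lia.
rewrite gbin_pascal // binS bin1 [q ^+ ('C(k, 2) + k)]exprD [q ^+ (k + _)]exprD.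
by rewrite [y ^+ k.+1]exprSr; ring.
Qed.

End TripleProduct.

Section TripleProductLimit.
Context {R : realType}.
Notation C := R[i].
Notation nm := (@ComplexField.Normc.normc R).
Notation i_pi := (@ipi R).

Context (tau : C) (tau_gt0 : 0 < complex.Im tau).
Implicit Types (u v : C) (j : int).

Definition nome := cexp (2 * i_pi * tau).
Local Notation q := nome.

Lemma nm_nome : nm q = expR (- (2 * pi * complex.Im tau)).
Proof.
rewrite nm_cexp /ipi; case: (tau) => a b /=.
by congr expR; ring.
Qed.

Lemma nome_lt1 : nm q < 1.
Proof. by rewrite nm_nome expR_lt1 oppr_lt0 !mulr_gt0 // pi_gt0. Qed.

Lemma nome_gt0 : 0 < nm q.
Proof. by rewrite nm_nome expR_gt0. Qed.

(* [theta_term j u] is [(-1)^j q^(j(j+1)/2) x^(j+1/2)] for [x = e^(2 pi i u)]. *)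
Definition theta_term j u : C :=
  cexp (i_pi * (j%:~R + tau * (j%:~R * (j%:~R + 1)) + u * (2 * j%:~R + 1))).

Definition theta_trunc m u : C :=
  (cexp (i_pi * u) - cexp (- (i_pi * u))) *
  qpoch q (q * cexp (2 * i_pi * u)) m * qpoch q (q / cexp (2 * i_pi * u)) m.

(** Each factor with a negative power of [q] is turned around by [1 - Y = - Y (1 - 1 / Y)], and the
    order of the factors is reversed. *)
Lemma qpoch_reflect m (X : C) : X != 0 ->
  qpoch q (X / q ^+ m) m =
  \prod_(0 <= s < m) (- X / q ^+ s.+1) * qpoch q (q / X) m.
Proof.
have q0 : q != 0 by exact: cexp_neq0.
move=> X0; rewrite /qpoch -big_split /= big_nat_rev /=.
apply: eq_big_nat => s /andP[_ sm]; rewrite add0n.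
have -> : q ^+ m = q ^+ (m - s.+1) * q ^+ s.+1 by rewrite -exprD subnK.
rewrite exprS.
have := expf_neq0 s q0; have := expf_neq0 (m - s.+1) q0.
move: (q ^+ s) (q ^+ (m - s.+1)) => a b a0 b0.
by field; rewrite a0 b0 X0 q0.
Qed.

Lemma qpochD (x : C) m n : qpoch q x (m + n) = qpoch q x m * qpoch q (q ^+ m * x) n.
Proof.
elim: n => [|n IH]; first by rewrite addn0 qpoch0 mulr1.
by rewrite addnS !qpochS IH exprD -!mulrA [q ^+ n * (_ * _)]mulrCA.
Qed.

(** The finite form of the Jacobi triple product: by reflection, the [2 m + 1] consecutive factors
    starting at [X / q^m] are those of both truncated products together with [1 - X], and [rothe]
    expands them. *)
Lemma theta_truncE m u : theta_trunc m u =
  \sum_(0 <= k < (2 * m).+2) gbin q (2 * m).+1 k * theta_term (k%:Z - m.+1%:Z) u.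
Proof.
have q0 : q != 0 by exact: cexp_neq0.
set X := cexp (2 * i_pi * u).
have X0 : X != 0 by exact: cexp_neq0.
(* The monomial by which the truncated theta function and the run of [2 m + 1] factors differ, up to
   sign; [preE] writes it as one exponential. *)
set pre := cexp (- (i_pi * u)) * \prod_(0 <= s < m) (- X / q ^+ s.+1)^-1.
have preE : pre = cexp (i_pi * (- m%:R - u * (2 * m%:R + 1) + tau * (m%:R * (m%:R + 1)))).
  rewrite /pre; elim: (m) => [|k IH].
    by rewrite big_geq // mulr1; congr cexp; ring.
  rewrite big_nat_recr //= [LHS]mulrA IH -[X in X * _]mulr1.
  have -> : (- X / q ^+ k.+1)^-1 =
      cexp (- i_pi - 2 * i_pi * u + k.+1%:R * (2 * i_pi * tau)).
    rewrite !cexpD !cexpN cexpMn cexp_ipi -/q -/X invfM invrK invrN invrN1; ring.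
  by rewrite mulr1 -cexpD; congr cexp; rewrite -natr1; ring.
have -> : theta_trunc m u = - pre * qpoch q (X / q ^+ m) (2 * m).+1.
  rewrite mul2n -addnn -addnS qpochD [q ^+ m * _]mulrC divfK ?expf_neq0 //.
  rewrite qpoch_reflect // /pre /theta_trunc -/X.
  have -> : qpoch q X m.+1 = (1 - X) * qpoch q (q * X) m.
    rewrite -addn1 addnC qpochD qpochS qpoch0 expr0 !mul1r expr1 //.
  have cX : cexp (i_pi * u) = X * cexp (- (i_pi * u)).
    by rewrite -cexpD; congr cexp; ring.
  have XV : \prod_(0 <= s < m) (- X / q ^+ s.+1)^-1 *
            \prod_(0 <= s < m) (- X / q ^+ s.+1) = 1.
    rewrite -big_split /= big1 // => s _; rewrite mulVf //.
    by rewrite mulf_eq0 oppr_eq0 (negbTE X0) invr_eq0 expf_eq0 (negbTE q0) andbF.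
  rewrite cX; set c := cexp _; set Q1 := qpoch _ _ _; set Q2 := qpoch _ _ _.
  transitivity (- c * (1 - X) * Q1 * Q2 * (\prod_(0 <= s < m) (- X / q ^+ s.+1)^-1 *
            \prod_(0 <= s < m) (- X / q ^+ s.+1))); last by ring.
  by rewrite XV; ring.
have -> : X / q ^+ m = - (- X / q ^+ m) by rewrite mulNr opprK.
rewrite rothe ?nome_lt1 // mulr_sumr; apply: eq_big_nat => k _.
rewrite mulrCA; congr (_ * _); rewrite preE.
have -> : - X / q ^+ m = cexp (i_pi + 2 * i_pi * u - m%:R * (2 * i_pi * tau)).
  by rewrite !cexpD cexpN cexpMn cexp_ipi -/q -/X; ring.
(* With the binomial coefficient as a quadratic polynomial, both sides become exponentials and only
   their exponents have to be compared. *)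
have C2 : ('C(k, 2)%:R : C) = k%:R * (k%:R - 1) / 2.
  elim: (k) => [|l IH]; first by rewrite mul0r mul0r.
  by rewrite binS bin1 natrD IH -(natr1 l); field.
have N1 : -1 = cexp (- i_pi) by rewrite cexpN cexp_ipi invrN1.
rewrite -[- cexp _]mulN1r N1 -!cexpMn C2 -!cexpD /theta_term; congr cexp.
rewrite rmorphB /= -!pmulrn -(natr1 m).
by field.
Qed.

End TripleProductLimit.

(** * Decay of the theta series and convergence rate of the Gaussian binomials *)

Section Decay.
Context {R : realType}.
Notation C := R[i].
Notation nm := (@ComplexField.Normc.normc R).
Notation i_pi := (@ipi R).

(** The exponential dominates its cubic Taylor term, so the sequence is [O (1 / (n + 1))]. The
    square allows for the number of terms in a double sum over a box. *)
Lemma cvg_sqr_geometric (K r : R) : 0 <= K -> 0 < r < 1 ->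
  ((fun n => K * n.+1%:R ^+ 2 * r ^+ n) @ \oo --> (0 : R))%classic.
Proof.
move=> K0 /andP[r0 r1]; set L := - ln r.
have L0 : 0 < L by rewrite oppr_gt0 ln_lt0 // r0 r1.
have rE n : r ^+ n.+1 = expR (- (L * n.+1%:R)).
  by rewrite /L mulNr opprK expRM_natr lnK.
set B := K * r^-1 * 6 / L ^+ 3.
have B0 : 0 <= B by rewrite !mulr_ge0 ?invr_ge0 ?exprn_ge0 // ltW.
have main n : K * n.+1%:R ^+ 2 * r ^+ n <= B * n.+1%:R^-1.
  have n0 : 0 < n.+1%:R :> R by rewrite ltr0n.
  have x0 : 0 <= L * n.+1%:R by rewrite mulr_ge0 // ltW.
  have := expR_ge1Dxn 2 x0; rewrite (_ : 3`!%:R = 6) // => H.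
  have {}H : (L * n.+1%:R) ^+ 3 / 6 <= expR (L * n.+1%:R) by lra.
  have E : r ^+ n.+1 <= 6 / (L * n.+1%:R) ^+ 3.
    have p : 0 < (L * n.+1%:R) ^+ 3 / 6 by rewrite divr_gt0 // exprn_gt0 // mulr_gt0.
    rewrite rE expRN -[6 / _]invf_div lef_pV2 ?posrE ?expR_gt0 //.
  have -> : K * n.+1%:R ^+ 2 * r ^+ n = K * n.+1%:R ^+ 2 * r^-1 * r ^+ n.+1.
    by rewrite [r ^+ n.+1]exprS; field; rewrite gt_eqF.
  have -> : B * n.+1%:R^-1 = K * n.+1%:R ^+ 2 * r^-1 * (6 / (L * n.+1%:R) ^+ 3).
    by rewrite /B; field; rewrite !gt_eqF.
  by rewrite ler_wpM2l // !mulr_ge0 ?invr_ge0 ?exprn_ge0 // ltW.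
have cB : ((fun n => B * n.+1%:R^-1) @ \oo --> (0 : R))%classic.
  have := cvgM (cvg_cst B) (@cvg_harmonic R).
  by rewrite mulr0; exact.
apply: (squeeze_cvgr _ (cvg_cst (0 : R)) cB).
apply: nearW => n; rewrite main andbT.
by rewrite !mulr_ge0 ?exprn_ge0 // ltW.
Qed.

Context (tau : C) (tau_gt0 : 0 < complex.Im tau).

Lemma intC (j : int) : j%:~R = (j%:~R)%:C :> C.
Proof. by rewrite (rmorph_int (real_complex R)). Qed.

Lemma theta_term_decay u (e : R) : 0 < e < 1 ->
  exists2 M, 0 <= M & forall j : int, nm (theta_term tau j u) <= M * e ^+ `|j|%N.
Proof.
move=> /andP[e0 e1]; set L := - ln e.
have L0 : 0 < L by rewrite oppr_gt0 ln_lt0 // e0 e1.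
set a := pi * complex.Im tau; set b := pi * complex.Im u.
have a0 : 0 < a by rewrite mulr_gt0 // pi_gt0.
(* The coefficient of [|j|] in the exponent after crude bounds on the linear terms and after moving
   [L |j|] over. Completing the square against [a j^2] leaves [E^2 / (4 a)]. *)
pose E := a + 2 * `|b| + L.
exists (expR (`|b| + E ^+ 2 / (4 * a))); first exact: expR_ge0.
move=> j; rewrite nm_cexp.
have -> : e ^+ `|j|%N = expR (- (L * `|j|%N%:R)).
  by rewrite /L mulNr opprK expRM_natr lnK.
rewrite -expRD ler_expR intC.
have -> : complex.Re (i_pi * ((j%:~R)%:C + tau * ((j%:~R)%:C * ((j%:~R)%:C + 1)) +
    u * (2 * (j%:~R)%:C + 1))) =
    - (a * (j%:~R * (j%:~R + 1)) + b * (2 * j%:~R + 1)).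
  by rewrite /a /b /ipi; case: (tau) (u) => [t1 t2] [u1 u2] /=; ring.
have -> : (`|j|%N%:R : R) = `|j%:~R| by rewrite -intr_norm -abszE.
move: (j%:~R : R) => y.
have h1 : y ^+ 2 = `|y| ^+ 2 by rewrite real_normK ?num_real.
have h2 : - y <= `|y| by rewrite -normrN ler_norm.
have h3 : - (b * y) <= `|b| * `|y| by rewrite -normrM -normrN ler_norm.
have h4 : - b <= `|b| by rewrite -normrN ler_norm.
have h5 : - (a * y) <= a * `|y| by rewrite -mulrN ler_wpM2l // ltW.
have h6 : 0 <= a * (`|y| - E / (2 * a)) ^+ 2 by rewrite mulr_ge0 ?sqr_ge0 // ltW.
have h7 : a * (`|y| - E / (2 * a)) ^+ 2 = a * y ^+ 2 - E * `|y| + E ^+ 2 / (4 * a).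
  by rewrite h1; field; rewrite gt_eqF.
rewrite h7 in h6; move: h6; rewrite /E; move: (E ^+ 2 / (4 * a)) => Z h6.
nra.
Qed.

Local Notation q := (nome tau).
Local Notation kap := (qphi q q).

(** The bound is not small when [k] is near 0 or near [n]; there the decay of the theta terms will
    compensate. *)
Lemma gbin_rate : exists2 K, 0 <= K & forall n k, (k <= n)%N ->
  nm (gbin q n k - kap^-1) <= K * (nm q ^+ k + nm q ^+ (n - k)).
Proof.
move: (nome_lt1 tau_gt0); move: (nome tau) => q q1.
have [l [K0 Hl]] := qpoch_cauchy q1 q.
have kl : (qphi q q) = l.
  by apply: (@cvgC_unique _ (qpoch q q)); [exact: cvg_qphi|
    apply: cvgC_bound Hl _; exact: cvg_nm_geometric].
have k0 : (qphi q q) != 0 by exact: qphi_qq_neq0.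
rewrite -kl in Hl; clear l kl.
have K00 : 0 <= K0 by have := Hl 0%N; rewrite expr0 mulr1; apply: le_trans; exact: nm_ge0.
have [E1 E1g HE1] : exists2 E, 0 <= E & forall n, nm (qfact q n) <= E.
  by exists (expR (nm q / (1 - nm q))); [exact: expR_ge0|move=> n; exact: qpoch_bound].
have [E2 E2g HE2] : exists2 E, 0 <= E & forall n, nm (qfact q n)^-1 <= E.
  by exists (expR ((1 - nm q)^-1 / (1 - nm q))); 
      [exact: expR_ge0|move=> n; exact: qfact_inv_bound].
set g := nm (qphi q q); have g0 : 0 <= g by exact: nm_ge0.
exists (E2 * E2 * nm (qphi q q)^-1 * (K0 * (g + g + E1))).
  by rewrite !mulr_ge0 ?nm_ge0 // !addr_ge0.
move=> n k kn; rewrite /gbin.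
set x := qfact q k; set y := qfact q (n - k); set z := qfact q n.
have x0 : x != 0 by exact: qfact_neq0.
have y0 : y != 0 by exact: qfact_neq0.
(* The difference is written through the distances of the three q-factorials from their common
   limit. *)
have -> : z / (x * y) - (qphi q q)^-1 = x^-1 * y^-1 * (qphi q q)^-1 *
   ((qphi q q) * ((qphi q q) - x) - (qphi q q) * ((qphi q q) - z) + x * ((qphi q q) - y)).
  by field; rewrite k0 x0 y0.
have r0 : 0 <= nm q by exact: nm_ge0.
have rkn : nm q ^+ n <= nm q ^+ k by rewrite ler_wiXn2l // ltW.
have r1 := exprn_ge0 k r0; have r2 := exprn_ge0 (n - k) r0.
rewrite !ComplexField.Normc.normcM -!mulrA ler_pM ?nm_ge0 ?mulr_ge0 ?nm_ge0 ?HE2 //.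
rewrite ler_pM ?nm_ge0 ?mulr_ge0 ?nm_ge0 ?HE2 //.
rewrite ler_wpM2l ?nm_ge0 //.
apply: le_trans (nmD _ _) _; apply: le_trans (lerD (nmB _ _) (lexx _)) _.
rewrite !ComplexField.Normc.normcM -/g.
have hx := Hl k; have hy := Hl (n - k)%N; have hz := Hl n.
have gx : g * nm ((qphi q q) - x) <= g * (K0 * nm q ^+ k) by rewrite ler_wpM2l.
have gz : g * nm ((qphi q q) - z) <= g * (K0 * nm q ^+ k).
  by rewrite ler_wpM2l //; apply: le_trans hz _; rewrite ler_wpM2l.
have gy : nm x * nm ((qphi q q) - y) <= E1 * (K0 * nm q ^+ (n - k)).
  by rewrite ler_pM ?nm_ge0 //; exact: HE1.
apply: le_trans (lerD (lerD gx gz) gy) _.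
set rk := nm q ^+ k in r1 *; set rn := nm q ^+ (n - k) in r2 *.
have p1 : 0 <= K0 * E1 * rk by rewrite !mulr_ge0.
have p2 : 0 <= K0 * g * rn by rewrite !mulr_ge0.
nra.
Qed.

End Decay.

(** * From the triple product to the three-term relation *)

Section ThreeTerm.
Context {R : realType}.
Notation C := R[i].
Notation nm := (@ComplexField.Normc.normc R).
Notation i_pi := (@ipi R).

Lemma nm_sum_le (T : eqType) (s : seq T) (P : pred T) (F : T -> C) (B : R) :
  0 <= B -> (forall x, x \in s -> P x -> nm (F x) <= B) ->
  nm (\sum_(x <- s | P x) F x) <= (size s)%:R * B.
Proof.
move=> B0; elim: s => [|x s IH] H.
  by rewrite big_nil ComplexField.Normc.normc0 mul0r.
rewrite big_cons /= -natr1 mulrDl mul1r [_ * B + B]addrC.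
have {}IH : nm (\sum_(x <- s | P x) F x) <= (size s)%:R * B.
  by apply: IH => y ys; apply: H; rewrite inE ys orbT.
case: ifP => Px; last by apply: le_trans IH _; rewrite lerDr.
by apply: le_trans (nmD _ _) _; rewrite lerD // H // inE eqxx.
Qed.

Context (tau : C) (tau_gt0 : 0 < complex.Im tau).
Local Notation q := (nome tau).
Local Notation kap := (qphi q q).
Local Notation term := (theta_term tau).

Lemma cvg_theta_trunc u : theta_trunc tau ^~ u ~> theta tau u.
Proof.
rewrite /theta /theta_trunc !ipi2E.
apply: cvgCM; last exact/cvg_qphi/nome_lt1.
by apply: cvgCM; [exact: cvgC_cst|exact/cvg_qphi/nome_lt1].
Qed.

Definition window m : seq int := [seq k%:Z - m.+1%:Z | k <- index_iota 0 (2 * m).+2].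

Lemma mem_window m (j : int) : (j \in window m) = (- m.+1%:Z <= j <= m%:Z).
Proof.
apply/mapP/idP => [[k]|H].
  by rewrite mem_index_iota => H ->; lia.
exists (absz (j + m.+1%:Z)); first by rewrite mem_index_iota; lia.
by lia.
Qed.

Lemma uniq_window m : uniq (window m).
Proof. by rewrite map_inj_uniq ?iota_uniq // => a b /=; lia. Qed.

Lemma size_window m : size (window m) = (2 * m).+2.
Proof. by rewrite size_map size_iota subn0. Qed.

Definition theta_sum m u := \sum_(j <- window m) term j u.

(** The Jacobi triple product as a limit of partial sums. For [j = k - (m + 1)], both [k + |j|] and
    [(2 m + 1 - k) + |j|] are at least [m]; so each of the [2 m + 2] errors is [O (|q|^m)], provided
    the terms decay at rate [|q|]. *)
Lemma cvg_theta_sum u : theta_sum ^~ u ~> kap * theta tau u.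
Proof.
have q1 := nome_lt1 tau_gt0; have q0 := nome_gt0 tau.
have k0 : kap != 0 by exact: qphi_qq_neq0.
have [K K0 HK] := gbin_rate tau_gt0.
have [|M M0 HM] := @theta_term_decay _ _ tau_gt0 u (nm q); first by rewrite q0 q1.
pose d m := theta_trunc tau m u - kap^-1 * theta_sum m u.
have d0 : d ~> 0.
  apply: (@cvgC_bound _ _ _ (fun m => 4 * K * M * m.+1%:R ^+ 2 * nm q ^+ m)); last first.
    by apply: cvg_sqr_geometric; rewrite ?mulr_ge0 // q0 q1.
  move=> m; rewrite sub0r nmN /d theta_truncE // /theta_sum big_map mulr_sumr.
  rewrite -sumrB.
  apply: le_trans (_ : (2 * m).+2%:R * (2 * K * M * nm q ^+ m) <= _); last first.
    have -> : (2 * m).+2%:R = 2 * m.+1%:R :> R by rewrite -natrM; congr (_%:R); lia.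
    have m1 : 1 <= m.+1%:R :> R by rewrite ler1n.
    have p : 0 <= K * M * nm q ^+ m by rewrite !mulr_ge0 ?exprn_ge0 // ltW.
    have : m.+1%:R * (K * M * nm q ^+ m) <= m.+1%:R ^+ 2 * (K * M * nm q ^+ m).
      by rewrite ler_wpM2r // expr2 ler_peMr.
    lra.
  have sE : (2 * m).+2 = size (index_iota 0 (2 * m).+2) by rewrite size_iota subn0.
  rewrite {2}sE. apply: nm_sum_le; first by rewrite !mulr_ge0 ?exprn_ge0 // ltW.
  move=> k; rewrite mem_index_iota => /andP[_ km] _.
  rewrite -mulrBl [leLHS]ComplexField.Normc.normcM.
  apply: le_trans (ler_pM (nm_ge0 _) (nm_ge0 _) (HK (2 * m).+1 k km) (HM _)) _.
  set a := absz _.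
  have e1 : nm q ^+ k * nm q ^+ a <= nm q ^+ m.
    by rewrite -exprD ler_wiXn2l ?ltW //; rewrite /a; lia.
  have e2 : nm q ^+ ((2 * m).+1 - k) * nm q ^+ a <= nm q ^+ m.
    by rewrite -exprD ler_wiXn2l ?ltW //; rewrite /a; lia.
  have -> : K * (nm q ^+ k + nm q ^+ ((2 * m).+1 - k)) * (M * nm q ^+ a) =
    K * M * (nm q ^+ k * nm q ^+ a + nm q ^+ ((2 * m).+1 - k) * nm q ^+ a).
    by ring.
  have -> : 2 * K * M * nm q ^+ m = K * M * (nm q ^+ m + nm q ^+ m) by ring.
  by rewrite ler_wpM2l ?mulr_ge0 // lerD.
have -> : theta_sum^~ u = (fun m => kap * (theta_trunc tau m u - d m)).
  by apply/funext => m; rewrite /d opprB addrC subrK mulrA divff // mul1r.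
rewrite -[theta tau u]subr0.
apply: cvgCM; first exact: cvgC_cst.
exact: cvgCB (@cvg_theta_trunc u) d0.
Qed.

(** The terms of [F]: their series is Jacobi's theta function [theta_2] at argument [2 u] and
    modulus [2 tau], up to the constant [q^(-1/4)]. *)
Definition theta_odd_term (l : int) u : C :=
  cexp (i_pi * (2 * tau * (l%:~R * (l%:~R + 1)) + (4 * l%:~R + 2) * u)).

(** The terms of [G]: their series is [theta_3] at argument [2 u] and modulus [2 tau]. *)
Definition theta_even_term (l : int) u : C :=
  cexp (i_pi * (2 * tau * l%:~R ^+ 2 + 4 * l%:~R * u)).

Lemma cexp_2ipi_int (l : int) : cexp (i_pi * (2 * l%:~R)) = 1 :> C.
Proof.
have E n : cexp (i_pi * (2 * n%:R)) = 1 :> C.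
  have -> : i_pi * (2 * n%:R) = n%:R * i_pi + n%:R * i_pi by ring.
  by rewrite cexpD cexpMn cexp_ipi -exprMn mulrNN mulr1 expr1n.
case: l => n; first by rewrite -pmulrn E.
by rewrite NegzE rmorphN /= !mulrN cexpN -pmulrn E invr1.
Qed.

(** For [j = l + x] and [k = l - x] the quadratic form [j^2 + k^2] is [2 l^2 + 2 x^2], so the
    variables separate; the sign [(-1)^(j + k)] is 1. *)
Lemma theta_termM_even (l x : int) u v :
  term (l + x) (u + v) * term (l - x) (u - v) =
  theta_odd_term l u * theta_even_term x v.
Proof.
rewrite -[RHS]mul1r -(cexp_2ipi_int l) -!cexpD; congr cexp.
by rewrite rmorphB rmorphD /=; ring.
Qed.

(** The same separation for [j + k = 2 l - 1]. The odd sum produces the minus sign of the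
    determinant. *)
Lemma theta_termM_odd (l x : int) u v :
  term (l + x) (u + v) * term (l - x - 1) (u - v) =
  - (theta_even_term l u * theta_odd_term x v).
Proof.
have N1 : -1 = cexp (- i_pi) by rewrite cexpN cexp_ipi invrN1.
rewrite -[RHS]mulN1r N1 -[RHS]mul1r -(cexp_2ipi_int l) -!cexpD; congr cexp.
by rewrite !rmorphB rmorphD /=; ring.
Qed.

Definition box m := [seq (j, k) | j <- window m, k <- window m].

#[local] Arguments box : simpl never.
#[local] Arguments window : simpl never.

Lemma mem_box m (p : int * int) :
  (p \in box m) = (p.1 \in window m) && (p.2 \in window m).
Proof.
case: p => j k; apply/allpairsP/andP => [[[a b] [/= am bm [-> ->]]] //|[jm km]].
by exists (j, k).
Qed.

Definition shear0 (p : int * int) := (p.1 + p.2, p.1 - p.2).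
Definition shear1 (p : int * int) := (p.1 + p.2, p.1 - p.2 - 1).

(** The parity of [j + k] decides which shear reaches [(j, k)]. Solving for the preimage at most
    about doubles the coordinates, hence the larger box of size [2 m + 2]. *)
Lemma perm_box_shear m (n := m.*2.+2) :
  perm_eq (box m)
    ([seq shear0 p | p <- box n & shear0 p \in box m] ++
     [seq shear1 p | p <- box n & shear1 p \in box m]).
Proof.
have ub k : uniq (box k) by apply: allpairs_uniq; rewrite ?uniq_window // => -[? ?] [? ?].
apply: uniq_perm => //.
  rewrite cat_uniq; apply/and3P; split.
  - rewrite map_inj_uniq ?filter_uniq ?ub //.
    by move=> [l x] [l' x'] [] h1 h2; congr pair; lia.
  - apply/hasPn => _ /mapP[[l x] _ ->].
    by apply/mapP => -[[l' x'] _ []]; lia.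
  rewrite map_inj_uniq ?filter_uniq ?ub //.
  by move=> [l x] [l' x'] [] h1 h2; congr pair; lia.
move=> [j k]; rewrite [RHS]mem_cat; apply/idP/idP; last first.
  by move=> /orP[] /mapP[p]; rewrite mem_filter => /andP[H _] ->.
move=> jk; apply/orP.
have /andP[jw kw] : (j \in window m) && (k \in window m) by move: jk; rewrite mem_box.
rewrite !mem_window in jw kw.
have [e|e] : (j + k = 2 * ((j + k) %/ 2)%Z)%R \/ (j + k = 2 * ((j + k) %/ 2)%Z + 1)%R.
- by lia.
- left; apply/mapP; exists (((j + k) %/ 2)%Z, j - ((j + k) %/ 2)%Z); last first.
    by rewrite /shear0 /=; congr pair; lia.
  rewrite mem_filter mem_box /= !mem_window /shear0 mem_box /= !mem_window /n.
  by apply/andP; split; lia.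
right; apply/mapP; exists (((j + k) %/ 2)%Z + 1, j - ((j + k) %/ 2)%Z - 1); last first.
  by rewrite /shear1 /=; congr pair; lia.
rewrite mem_filter mem_box /= !mem_window /shear1 mem_box /= !mem_window /n.
by apply/andP; split; lia.
Qed.

Definition odd_sum n u := \sum_(l <- window n) theta_odd_term l u.
Definition even_sum n u := \sum_(l <- window n) theta_even_term l u.

(** The determinant of partial sums runs over all sheared points of the large box, the product of
    theta sums over those inside the small box. Each point in the difference has a coordinate beyond
    [m], so its term is exponentially small. *)
Lemma cvg_theta_pair u v :
  (fun m => odd_sum m.*2.+2 u * even_sum m.*2.+2 v -
            even_sum m.*2.+2 u * odd_sum m.*2.+2 v)
    ~> kap ^+ 2 * (theta tau (u + v) * theta tau (u - v)).
Proof.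
(* Any rate strictly between 0 and 1 would serve. *)
have h01 : (0 : R) < (2^-1 : R) < (1 : R) by apply/andP; split; lra.
have [M M0 HM] := theta_term_decay tau_gt0 (u + v) h01.
have [M' M'0 HM'] := theta_term_decay tau_gt0 (u - v) h01.
pose T (p : int * int) := term p.1 (u + v) * term p.2 (u - v).
pose H m := odd_sum m.*2.+2 u * even_sum m.*2.+2 v -
            even_sum m.*2.+2 u * odd_sum m.*2.+2 v.
pose S m := theta_sum m (u + v) * theta_sum m (u - v).
have HE m : H m = \sum_(p <- box m.*2.+2) T (shear0 p) +
                  \sum_(p <- box m.*2.+2) T (shear1 p).
  rewrite /H /odd_sum /even_sum !big_distrlr /= !big_allpairs -sumrN.
  congr (_ + _); apply: eq_bigr => l _; rewrite -?sumrN; apply: eq_bigr => x _.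
    by rewrite -theta_termM_even.
  by rewrite -theta_termM_odd.
have SE m : S m = \sum_(p <- box m.*2.+2 | shear0 p \in box m) T (shear0 p) +
                  \sum_(p <- box m.*2.+2 | shear1 p \in box m) T (shear1 p).
  have -> : S m = \sum_(p <- box m) T p.
    by rewrite /S /theta_sum big_distrlr /= big_allpairs.
  by rewrite (perm_big _ (perm_box_shear m)) big_cat !big_map !big_filter.
have dE m : H m - S m = \sum_(p <- box m.*2.+2 | shear0 p \notin box m) T (shear0 p) +
                  \sum_(p <- box m.*2.+2 | shear1 p \notin box m) T (shear1 p).
  rewrite HE SE.
  rewrite [\sum_(p <- box m.*2.+2) T (shear0 p)](bigID (fun p => shear0 p \in box m)).
  rewrite [\sum_(p <- box m.*2.+2) T (shear1 p)](bigID (fun p => shear1 p \in box m)).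
  by rewrite opprD addrACA [X in X + _]addrAC subrr add0r [X in _ + X]addrAC subrr add0r.
have bT m p : p \notin box m -> nm (T p) <= M * M' * 2^-1 ^+ m.
  move=> pm; rewrite /T ComplexField.Normc.normcM.
  apply: le_trans (ler_pM (nm_ge0 _) (nm_ge0 _) (HM _) (HM' _)) _.
  rewrite mulrACA ler_wpM2l ?mulr_ge0 // -exprD ler_wiXn2l //; try by lra.
  by move: pm; rewrite mem_box !mem_window; lia.
have d0 : (fun m => H m - S m) ~> 0.
  (* Two families of at most [(4 m + 6)^2] points each, and [2 (4 m + 6)^2 <= 72 (m + 1)^2]. *)
  apply: (@cvgC_bound _ _ _ (fun m => (72 * (M * M')) * m.+1%:R ^+ 2 * 2^-1 ^+ m)); last first.
    by apply: cvg_sqr_geometric => //; rewrite !mulr_ge0.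
  move=> m; rewrite sub0r nmN dE; apply: le_trans (nmD _ _) _.
  have B0 : 0 <= M * M' * 2^-1 ^+ m by rewrite !mulr_ge0 // exprn_ge0 // ltW; lra.
  apply: le_trans (lerD (nm_sum_le B0 _) (nm_sum_le B0 _)) _.
  - by move=> p _; exact: bT.
  - by move=> p _; exact: bT.
  rewrite size_allpairs size_window -mulrDl.
  have -> : 72 * (M * M') * m.+1%:R ^+ 2 * 2^-1 ^+ m =
            (72 * m.+1%:R ^+ 2) * (M * M' * 2^-1 ^+ m) by ring.
  rewrite ler_wpM2r // -natrX -natrD -natrM ler_nat; nia.
have -> : (fun m => H m) = (fun m => S m + (H m - S m)).
  by apply/funext => m; rewrite addrC subrK.
rewrite -[kap ^+ 2 * _]addr0; apply: cvgCD; last exact: d0.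
have -> : kap ^+ 2 * (theta tau (u + v) * theta tau (u - v)) =
   (kap * theta tau (u + v)) * (kap * theta tau (u - v)) by ring.
by apply: cvgCM; exact: cvg_theta_sum.
Qed.

Let H u v := theta tau (u + v) * theta tau (u - v).

(** The minors of partial sums satisfy the Pluecker relation exactly for every [m], so only the
    minors themselves need to converge. *)
Theorem theta_three_term u v w s :
  theta tau (u + v) * theta tau (u - v) * (theta tau (w + s) * theta tau (w - s)) -
  theta tau (u + w) * theta tau (u - w) * (theta tau (v + s) * theta tau (v - s)) +
  theta tau (u + s) * theta tau (u - s) * (theta tau (v + w) * theta tau (v - w)) = 0.
Proof.
have k0 : kap != 0 by exact/qphi_qq_neq0/nome_lt1.
pose F m := odd_sum m.*2.+2; pose G m := even_sum m.*2.+2.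
pose P a b m := F m a * G m b - G m a * F m b.
have cP a b : P a b ~> kap ^+ 2 * H a b by exact: cvg_theta_pair.
have : (fun m => P u v m * P w s m - P u w m * P v s m + P u s m * P v w m) ~>
  (kap ^+ 2 * H u v) * (kap ^+ 2 * H w s) -
  (kap ^+ 2 * H u w) * (kap ^+ 2 * H v s) + (kap ^+ 2 * H u s) * (kap ^+ 2 * H v w).
  by apply: cvgCD; [apply: cvgCB|]; apply: cvgCM; exact: cP.
have -> : (fun m => P u v m * P w s m - P u w m * P v s m + P u s m * P v w m) =
  (fun=> 0) by apply/funext => m; rewrite /P; ring.
move=> c0; have E := cvgC_unique c0 (@cvgC_cst _ 0).
have k4 : kap ^+ 4 != 0 by rewrite expf_neq0.
by rewrite -!/(H _ _); apply: (mulfI k4); rewrite mulr0 -[RHS]E; ring.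
Qed.

End ThreeTerm.

Section ThetaFunctionalForms.
Context {R : realType} (tau : R[i]).

Lemma theta_odd u : theta tau (- u) = - theta tau u.
Proof.
rewrite /theta !mulrN opprK !cexpN invrK.
set c := cexp (_ * u); set X := cexp (_ * u).
by rewrite -[c^-1 - c]opprB !mulNr mulrAC.
Qed.

(** Translating by [t / 2], with [s = t / 2], makes every argument an integral combination of
    [e, f, g, t]. The identities below can thus be matched over an arbitrary field without
    halving. *)
Lemma theta_three_term_shifted (tau_gt0 : 0 < complex.Im tau) e f g t :
  theta tau (e + f + t) * theta tau (e - f) * (theta tau (g + t) * theta tau g) -
  theta tau (e + g + t) * theta tau (e - g) * (theta tau (f + t) * theta tau f) +
  theta tau (e + t) * theta tau e * (theta tau (f + g + t) * theta tau (f - g)) = 0.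
Proof.
have := theta_three_term tau_gt0 (e + t / 2) (f + t / 2) (g + t / 2) (t / 2).
have h x y : x + t / 2 + (y + t / 2) = x + y + t by field.
have h' x : x + t / 2 + t / 2 = x + t by field.
have h'' x y : x + t / 2 - (y + t / 2) = x - y by ring.
by rewrite !h !h' !h'' !addrK.
Qed.

End ThetaFunctionalForms.

(** * Theta identities in the exchange step *)

Section ThetaIdentities.
Context {K : fieldType} (th : K -> K).
Hypothesis thN : forall u, th (- u) = - th u.
Hypothesis th3 : forall e f g t,
  th (e + f + t) * th (e - f) * (th (g + t) * th g) -
  th (e + g + t) * th (e - g) * (th (f + t) * th f) +
  th (e + t) * th e * (th (f + g + t) * th (f - g)) = 0.

(** The arguments are free and tied down by equations, because the instances below match the
    three-term relation only up to [ring]. *)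
Lemma th3_at e f g t a1 a2 a3 a4 b1 b2 b3 b4 c1 c2 c3 c4 :
  a1 = e + f + t -> a2 = e - f -> a3 = g + t -> a4 = g ->
  b1 = e + g + t -> b2 = e - g -> b3 = f + t -> b4 = f ->
  c1 = e + t -> c2 = e -> c3 = f + g + t -> c4 = f - g ->
  th a1 * th a2 * (th a3 * th a4) - th b1 * th b2 * (th b3 * th b4) +
  th c1 * th c2 * (th c3 * th c4) = 0.
Proof. by do 12!move=> ->; exact: th3. Qed.

Lemma thB u v : th (u - v) = - th (v - u).
Proof. by rewrite -thN opprB. Qed.

(* Interpolation of a theta function of degree 2 in [y1]; the case [A = h],
   [B = 0] is used as well. *)
Lemma th_pair x1 x2 y1 y2 A B :
  th (y1 - x2 + B) * th (y1 - y2 + (A - B)) * (th (y2 - x1 + A) * th (x1 - x2)) -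
  th (y1 - x2 + A) * th (y1 - y2) * (th (y2 - x1 + B) * th (x1 - x2 - (A - B))) -
  th (y1 - x1 + A) * th (y1 - y2 + (x1 - x2)) * (th (y2 - x2 + B) * th (A - B)) = 0.
Proof.
have := @th3_at (y1 - y2 + (x1 - x2)) (x1 - x2 - (A - B)) (x1 - x2)
  (y2 - x1 + A - (x1 - x2)) (y1 - x2 + B) (y1 - y2 + (A - B)) (y2 - x1 + A)
  (x1 - x2) (y1 - x2 + A) (y1 - y2) (y2 - x1 + B) (x1 - x2 - (A - B))
  (y1 - x1 + A) (y1 - y2 + (x1 - x2)) (y2 - x2 + B) (B - A).
rewrite (thB B A) !mulrN; apply; ring.
Qed.

Section ExchangeBothLevels.
Variables (h x1 x2 y1 y2 : K).

(** Numerator of the four [psi] factors of the pair when a level contains both elements: [x1, x2]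
    are their variables at that level, [y1, y2] those one level higher, and [P, Q] are their
    dynamical shifts. *)
Definition both_num P Q x1 x2 y1 y2 :=
  th (y1 - x1 + P) * th (y2 - x1) * th (y1 - x2 + h) * th (y2 - x2 + Q).

(** The coefficient of [f] in [both_loc_exchange]: a combination of [th_pair] at [(A, B)] and at
    [(h, 0)]. *)
Lemma both_num_exchange A B (D := A - B) (x := x1 - x2) (y := y1 - y2) :
  th (y + h) * th x * th D * both_num B A x2 x1 y2 y1 +
  th y * (th (h - x) * th D * both_num A B x1 x2 y1 y2 +
          th (x - D) * th h * both_num A B x2 x1 y1 y2) -
  th (y + D) * th h * th x * both_num B A x2 x1 y1 y2 = 0.
Proof.
have R2 := th_pair x1 x2 y1 y2 A B.
have := th_pair x1 x2 y1 y2 h 0; rewrite !addr0 !subr0 => R1.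
rewrite -[RHS](mulr0 (th D * th (y2 - x2 + B) * th (y1 - x1 + A))) -R1.
rewrite -[RHS]subr0 -(mulr0 (th h * th (y2 - x2) * th (y1 - x1 + h))) -R2.
rewrite /both_num -/D -/x -/y (thB h x).
ring.
Qed.

End ExchangeBothLevels.

(** The coefficient of [g] in [both_loc_exchange]. After multiplication by [th x] it follows from
    [both_num_exchange], its mirror image under [x1 <-> x2], and the three-term relation among [h],
    [D] and [x]. *)
Lemma both_num_exchange2 h x1 x2 y1 y2 A B (D := A - B) (x := x1 - x2) (y := y1 - y2)
  (Z := fun x1 x2 => th D * th (y + h) * both_num h B A x2 x1 y2 y1 -
                     th h * th (y + D) * both_num h B A x2 x1 y1 y2) :
  th x != 0 ->
  th h * th (x + D) * Z x1 x2 - th D * th (h - x) * Z x2 x1 +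
  th (h + D) * th (h - D) * th x * th y * both_num h A B x2 x1 y1 y2 = 0.
Proof.
move=> x0; apply: (mulfI x0); rewrite mulr0.
have := both_num_exchange h x1 x2 y1 y2 A B; cbv zeta => E1.
have := both_num_exchange h x2 x1 y1 y2 A B; cbv zeta.
have -> : x2 - x1 = - x by rewrite /x opprB.
have -> : - x - (A - B) = - (x + D) by rewrite /D; ring.
rewrite !thN opprK => E2.
have T : th (h + D) * th (h - D) * (th x * th x) - th (h + x) * th (h - x) * (th D * th D) +
         th h * th h * (th (D + x) * th (D - x)) = 0.
  by apply: (@th3_at h D x 0); ring.
have -> : th x * (th h * th (x + D) * Z x1 x2 - th D * th (h - x) * Z x2 x1 +
    th (h + D) * th (h - D) * th x * th y * both_num h A B x2 x1 y1 y2) =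
  th h * th (x + D) * 0 + th D * th (h - x) * 0 + th y * both_num h A B x2 x1 y1 y2 * 0.
  rewrite -{1}E1 -{1}E2 -T (addrC D x) (thB D x) /Z -/D -/x -/y; ring.
by rewrite !mulr0 !addr0.
Qed.

Lemma both_num_sym h x1 x2 y1 y2 A (x := x1 - x2)
  (F := fun y1 y2 => th (h + x) * both_num h A (A + h) x2 x1 y1 y2 -
                     th (h - x) * both_num h A (A + h) x1 x2 y1 y2) :
  th x != 0 -> th (A + h) != 0 -> F y1 y2 = F y2 y1.
Proof.
move=> x0 A0.
(* As theta functions of degree 2 in [z], the products in [y1] are expanded in the two products that
   occur in [y2]. In [F] the two mixed terms then have equal coefficients, which is the symmetry. *)
have Q1 z : th (z - x1 + A) * th (z - x2 + h) * (th x * th (A + h)) =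
  th A * th (h + x) * (th (z - x2) * th (z - x1 + (A + h))) -
  th (A - x) * th h * (th (z - x1) * th (z - x2 + (A + h))).
  have := @th3_at (z - x2) (- h) x (A + h - x) (z - x1 + A) (z - x2 + h) (A + h) x
    (z - x2 + (A + h)) (z - x1) (A - x) (- h) (z - x1 + (A + h)) (z - x2) A
    (- (h + x)).
  rewrite !thN /x => E; apply/eqP; rewrite -subr_eq0 -[X in _ == X]E; try ring.
  by apply/eqP; ring.
have Q2 z : th (z - x2 + A) * th (z - x1 + h) * (th x * th (A + h)) =
  th (A + x) * th h * (th (z - x2) * th (z - x1 + (A + h))) -
  th A * th (h - x) * (th (z - x1) * th (z - x2 + (A + h))).
  have := @th3_at (z - x1) (- h) (- x) (A + h + x) (z - x2 + A) (z - x1 + h) (A + h) (- x)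
    (z - x1 + (A + h)) (z - x2) (A + x) (- h) (z - x2 + (A + h)) (z - x1) A
    (- (h - x)).
  rewrite !thN /x => E; apply/eqP; rewrite -subr_eq0 -oppr_eq0 -[X in _ == X]E; try ring.
  by apply/eqP; ring.
have k0 : th x * th (A + h) != 0 by rewrite mulf_neq0.
have FE a b : th x * th (A + h) * F a b =
  th (h + x) * (th (a - x2 + A) * th (a - x1 + h) * (th x * th (A + h))) *
    (th (b - x2) * th (b - x1 + (A + h))) -
  th (h - x) * (th (a - x1 + A) * th (a - x2 + h) * (th x * th (A + h))) *
    (th (b - x1) * th (b - x2 + (A + h))).
  by rewrite /F /both_num; ring.
by apply: (mulfI k0); rewrite !FE !Q1 !Q2; ring.
Qed.

(** For the first level containing both elements. One level lower only a single variable [x] belongs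
    to the pair, and one instance of the three-term relation suffices, here and in
    [one_num_exchange2]. *)
Lemma one_num_exchange h D x y1 y2 (y := y1 - y2) :
  th D * th (y2 - x + h) * th (y1 - x + D) * th (y + h) -
  th (y + D) * th h * th (y1 - x + h) * th (y2 - x + D) +
  th y * th (h - D) * th (y1 - x + (h + D)) * th (y2 - x) = 0.
Proof.
have := @th3_at (y2 - x + h) h (h - D) (y - h + D) (y1 - x + (h + D)) (y2 - x)
  y (h - D) (y1 - x + h) (y2 - x + D) (y + D) h (y1 - x + D) (y2 - x + h) (y + h) D.
rewrite /y => E; rewrite -[RHS]E; ring.
Qed.

Lemma one_num_exchange2 h D x y1 y2 (y := y1 - y2) :
  th D * th (y + h) * th (y2 - x + (h + D)) * th (y1 - x) -
  th y * th (h + D) * th (y1 - x + h) * th (y2 - x + D) +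
  th (y - D) * th h * th (y1 - x + (h + D)) * th (y2 - x) = 0.
Proof.
have := @th3_at (y2 - x + (h + D)) h (h + D) (y - h - D) (y1 - x + h) (y2 - x + D)
  y (h + D) (y1 - x + (h + D)) (y2 - x) (y - D) h (y1 - x) (y2 - x + (h + D)) (y + h) (- D).
rewrite thN /y => E; rewrite -[RHS]oppr0 -[in RHS]E; ring.
Qed.

Definition both_loc h P Q x1 x2 y1 y2 :=
  th (y1 - x1 + P) / th P * th (y2 - x1) * th (y1 - x2 + h) *
  (th (y2 - x2 + Q) / th Q) * (th (x2 - x1 + h) / th (x2 - x1)).

Lemma both_locE h P Q x1 x2 y1 y2 : both_loc h P Q x1 x2 y1 y2 =
  - both_num h P Q x1 x2 y1 y2 * th (h - (x1 - x2)) / (th P * th Q * th (x1 - x2)).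
Proof.
rewrite /both_loc /both_num (thB x2 x1).
have -> : x2 - x1 + h = h - (x1 - x2) by ring.
rewrite !invfM invrN; ring.
Qed.

Lemma both_locE' h P Q x1 x2 y1 y2 : both_loc h P Q x2 x1 y1 y2 =
  both_num h P Q x2 x1 y1 y2 * th (x1 - x2 + h) / (th P * th Q * th (x1 - x2)).
Proof. by rewrite /both_loc /both_num !invfM; ring. Qed.

Lemma both_loc_sym h A x1 x2 y1 y2 : th (x1 - x2) != 0 -> th (A + h) != 0 ->
  both_loc h A (A + h) x1 x2 y2 y1 + both_loc h A (A + h) x2 x1 y2 y1 =
  both_loc h A (A + h) x1 x2 y1 y2 + both_loc h A (A + h) x2 x1 y1 y2.
Proof.
move=> x0 A0; rewrite !(both_locE _ _ _ x1 x2) !(both_locE' _ _ _ x1 x2) -!mulrDl.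
have := both_num_sym y2 y1 x0 A0; cbv zeta beta; rewrite (addrC h (x1 - x2)) => E.
congr (_ / _); rewrite !mulNr addrC [RHS]addrC.
by rewrite !(mulrC (both_num _ _ _ _ _ _ _)).
Qed.

(** The inductive step for one pair of permutations: [f, g] stand for the functions of [J] and
    [s (J)] at a level, [fs, gs] for their values after the interchange. The hypothesis on [c * c']
    is the compatibility of the two relations; by its symmetry the lemma serves both directions. *)
Lemma both_loc_exchange h x1 x2 y1 y2 A B f fs g gs c c'
    (D := A - B) (x := x1 - x2) (y := y1 - y2) :
  th A != 0 -> th B != 0 -> th D != 0 -> th x != 0 ->
  c * c' * th D ^+ 2 = - (th (h + D) * th (h - D)) ->
  th (x + h) * gs = c * th x * f + th (x + D) * th h / th D * g ->
  th (x + h) * fs = c' * th x * g + th (x - D) * th h / th (- D) * f ->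
  th (y + h) * (g * both_loc h B A x1 x2 y2 y1 + gs * both_loc h B A x2 x1 y2 y1) =
  c * th y * (f * both_loc h A B x1 x2 y1 y2 + fs * both_loc h A B x2 x1 y1 y2) +
  th (y + D) * th h / th D *
  (g * both_loc h B A x1 x2 y1 y2 + gs * both_loc h B A x2 x1 y1 y2).
Proof.
move=> A0 B0 D0 x0 cc Hg Hf.
have E1 := both_num_exchange h x1 x2 y1 y2 A B.
have E2 := @both_num_exchange2 h x1 x2 y1 y2 A B x0.
rewrite -/D -/x -/y in E1 E2.
rewrite !(both_locE _ _ _ x1 x2) !(both_locE' _ _ _ x1 x2) -/x.
move: E1 E2; rewrite /=.
set l1 := both_num h B A x2 x1 y2 y1; set l2 := both_num h A B x1 x2 y1 y2.
set l3 := both_num h A B x2 x1 y1 y2; set l4 := both_num h B A x2 x1 y1 y2.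
set l5 := both_num h B A x1 x2 y2 y1; set l6 := both_num h B A x1 x2 y1 y2.
move=> E1 E2.
have Hg' : gs * th (x + h) = c * th x * f + th (x + D) * th h / th D * g.
  by rewrite mulrC.
have Hf' : fs * th (x + h) = c' * th x * g - th (x - D) * th h / th D * f.
  by rewrite mulrC Hf thN invrN; ring.
(* By [both_locE'], [gs] and [fs] occur only next to a factor [th (x + h)], which is what [Hg] and
   [Hf] evaluate; so they are eliminated without dividing by it. *)
have S1 w l : w * (l * th (x + h) / (th A * th B * th x)) =
  w * th (x + h) * l / (th A * th B * th x) by ring.
have S2 w l : w * (l * th (x + h) / (th B * th A * th x)) =
  w * th (x + h) * l / (th A * th B * th x) by rewrite (mulrC (th B)); ring.
rewrite !S1 !S2 Hg' Hf'; apply/eqP; rewrite -subr_eq0; apply/eqP.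
transitivity ((c * f / (th A * th B * th D * th x)) * 0 +
  (g / (th A * th B * th D ^+ 2 * th x)) * 0
  - l3 * th y * g / (th A * th B * th D ^+ 2) *
    (c * c' * th D ^+ 2 - - (th (h + D) * th (h - D)))).
  rewrite -{1}E1 -E2; field; rewrite A0 B0 D0 x0 //.
by rewrite cc subrr !mulr0 !addr0 subr0.
Qed.

End ThetaIdentities.

(** * Weight functions level by level *)

Section LevelRecursion.
Context {R : realType} {n N : nat}.
Variables (tau : R[i]) (lam : 'I_N -> nat).
Implicit Types (J : 'I_N -> {set 'I_n}) (t : nat -> nat -> R[i]).
Implicit Types (F G : (nat -> nat -> R[i]) -> R[i]).

Lemma perm_level_comm k l m m' (s : 'S_m) (s' : 'S_m') t : k != l ->
  perm_level k s (perm_level l s' t) = perm_level l s' (perm_level k s t).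
Proof.
move=> kl; have lk : (l == k) = false by rewrite eq_sym (negbTE kl).
apply/funext => j; apply/funext => a; rewrite /perm_level (negbTE kl) lk.
by have [->|//] := eqVneq j k; rewrite (negbTE kl).
Qed.

Lemma perm_level_with_top k m (s : 'S_m) t (z : 'I_n -> R[i]) : k != N ->
  perm_level k s (with_top (N := N) t z) = with_top (N := N) (perm_level k s t) z.
Proof.
move=> kN; apply/funext => j; apply/funext => a; rewrite /perm_level /with_top.
by rewrite (negbTE kN); have [->|//] := eqVneq j k; rewrite (negbTE kN).
Qed.

Lemma foldr_symt_comm F k s t : k \notin s ->
  foldr (symt lam) (symt lam k F) s t = symt lam k (foldr (symt lam) F s) t.
Proof.
elim: s t => //= l s IH t; rewrite inE negb_or => /andP[kl ks].
rewrite {1}/symt; under eq_bigr do rewrite IH // /symt.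
rewrite exchange_big /symt /=; apply: eq_bigr => p _; apply: eq_bigr => p' _.
by rewrite perm_level_comm.
Qed.

Lemma foldr_symtM F G s t :
  (forall k (p : 'S_(lam_upto lam k)) t, k \in s -> G (perm_level k p t) = G t) ->
  foldr (symt lam) (fun t => F t * G t) s t = foldr (symt lam) F s t * G t.
Proof.
elim: s t => //= k s IH t HG; rewrite /symt mulr_suml; apply: eq_bigr => p _.
rewrite IH; last by move=> l p' t' ls; rewrite HG // inE ls orbT.
by rewrite HG // inE eqxx.
Qed.

Lemma foldr_symt_with_top F (z : 'I_n -> R[i]) s t : N \notin s ->
  foldr (symt lam) (fun t' => F (with_top (N := N) t' z)) s t =
  foldr (symt lam) F s (with_top (N := N) t z).
Proof.
elim: s t => //= k s IH t; rewrite inE negb_or => /andP[kN ks].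
apply: eq_bigr => p _; rewrite IH // perm_level_with_top //.
by rewrite eq_sym.
Qed.

Context (h : R[i]) (mu : 'I_N -> R[i]).

Definition U_at J (k : 'I_N) t : R[i] :=
  \prod_(a < lam_upto lam k)
    ((\prod_(c < lam_upto lam k.+1) psi_ell tau J k a c h mu (t k.+1 c - t k a)) *
     \prod_(b < lam_upto lam k | (a < b)%N)
        (theta tau (h + t k b - t k a) / theta tau (t k b - t k a))).

(* The part of [W_ell] that involves the variables of level at most [l],
   symmetrized over the levels below [l] only.  Level 0 has no variables, so
   that [symt lam 0] changes nothing. *)
Fixpoint W_upto J l t : R[i] :=
  if l is l'.+1 then
    symt lam l' (fun t => W_upto J l' t * \prod_(k < N | k == l' :> nat) U_at J k t) t
  else 1.

Lemma W_uptoS J l t : W_upto J l.+1 t = \sum_(p : 'S_(lam_upto lam l))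
  W_upto J l (perm_level l p t) *
  \prod_(k < N | k == l :> nat) U_at J k (perm_level l p t).
Proof. by []. Qed.

Lemma U_at_ext J (k : 'I_N) t t' : t k = t' k -> t k.+1 = t' k.+1 ->
  U_at J k t = U_at J k t'.
Proof. by rewrite /U_at => -> ->. Qed.

Lemma W_upto_ext J l t t' : (forall k, (k <= l)%N -> t k = t' k) ->
  W_upto J l t = W_upto J l t'.
Proof.
elim: l t t' => [//|l IH] t t' H; rewrite !W_uptoS; apply: eq_bigr => p _.
have E k : (k <= l.+1)%N -> perm_level l p t k = perm_level l p t' k.
  by move=> kl; apply/funext => a; rewrite /perm_level !H.
rewrite (IH _ (perm_level l p t')) => [|k kl]; last by rewrite E // ltnW.
congr (_ * _); apply: eq_bigr => k /eqP kl.
by apply: U_at_ext; rewrite E // kl.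
Qed.

Lemma lam_upto0 : lam_upto lam 0 = 0%N.
Proof. by rewrite /lam_upto big_pred0. Qed.

Lemma W_upto1 J t : W_upto J 1 t = 1.
Proof.
rewrite W_uptoS (eq_bigr (fun=> 1)) => [|p _].
  by rewrite sumr_const card_Sn lam_upto0 fact0.
rewrite mul1r big1 // => k /eqP k0.
rewrite /U_at big1 // => -[a al] _; exfalso.
by move: al; rewrite k0 lam_upto0.
Qed.

(** The highest level is symmetrized innermost in [W_ell] and outermost in [W_upto]. The sums
    commute, and the factor of level [l + 1] leaves the inner ones since it involves only levels
    [l + 1] and [l + 2]. *)
Lemma foldr_symt_W_upto J l t :
  foldr (symt lam) (fun t => \prod_(k < N | (0 < k < l.+1)%N) U_at J k t) (iota 1 l) t =
  W_upto J l.+1 t.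
Proof.
elim: l t => [|l IH] t.
  by rewrite W_upto1 /= big_pred0 // => k; case: (nat_of_ord k).
have -> : iota 1 l.+1 = iota 1 l ++ [:: l.+1] by have := iotaD 1 l 1; rewrite addn1.
rewrite foldr_cat [foldr _ _ [:: _]]/= foldr_symt_comm;
  last by rewrite mem_iota add1n ltnn andbF.
have -> : (fun t => \prod_(k < N | (0 < k < l.+2)%N) U_at J k t) =
  (fun t => (\prod_(k < N | (0 < k < l.+1)%N) U_at J k t) *
            \prod_(k < N | k == l.+1 :> nat) U_at J k t).
  apply/funext => t'; rewrite (bigID (fun k : 'I_N => (k < l.+1)%N)) /=.
  by congr (_ * _); apply: eq_bigl => k; lia.
rewrite W_uptoS; apply: eq_bigr => p _; rewrite foldr_symtM ?IH //.
move=> k p' t' /=; rewrite mem_iota => /andP[k0 kl].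
apply: eq_bigr => j /eqP jl; apply: U_at_ext; rewrite /perm_level jl;
  by case: eqP => // ?; lia.
Qed.

Lemma W_ell_upto J t z : (0 < N)%N ->
  W_ell tau lam J t z h mu =
  theta tau h ^+ (\sum_(k < N | (0 < k)%N) lam_upto lam k)%N *
  W_upto J N (with_top (N := N) t z).
Proof.
move=> N0; rewrite /W_ell; congr (_ * _).
rewrite (@foldr_symt_with_top (U_ell tau lam J h mu)); last by rewrite mem_iota; lia.
have -> : W_upto J N = W_upto J N.-1.+1 by rewrite prednK.
rewrite -foldr_symt_W_upto (_ : U_ell tau lam J h mu =
  fun t => \prod_(k < N | (0 < k < N.-1.+1)%N) U_at J k t) //.
by apply/funext => t'; apply: eq_bigl => k; rewrite (prednK N0) ltn_ord andbT.
Qed.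

(** Acts on natural positions rather than on an ordinal type, so that it applies equally to the top
    level, where the variables are [z]. *)
Definition swap_level l c t : nat -> nat -> R[i] := fun k a =>
  if k == l then t l (if a == c then c.+1 else if a == c.+1 then c else a) else t k a.

Lemma swap_level_perm l c (cl : (c.+1 < lam_upto lam l)%N) (p : 'S_(lam_upto lam l)) t :
  swap_level l c (perm_level l p t) =
  perm_level l (tperm (Ordinal (ltnW cl)) (Ordinal cl) * p)%g t.
Proof.
apply/funext => k; apply/funext => a; rewrite /swap_level /perm_level.
have [_|//] := eqVneq k l; rewrite eqxx.
set w := if a == c then _ else _.
have [al|al] := ltnP a (lam_upto lam l).
  have wl : (w < lam_upto lam l)%N by rewrite /w; do 2?case: ifP => _ //; exact: ltnW.
  rewrite (insubT (fun x => x < lam_upto lam l)%N wl).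
  rewrite (insubT (fun x => x < lam_upto lam l)%N al) /= permM.
  congr (t l (p _)); apply: val_inj; rewrite /= /w.
  case: tpermP => [[->]|[->]|/eqP + /eqP] /=; rewrite ?eqxx //.
    by rewrite (gtn_eqF (ltnSn c)).
  by rewrite -!val_eqE /= => /negbTE -> /negbTE ->.
have -> : w = a by rewrite /w; case: eqP => [|_]; [lia|case: eqP; lia].
by rewrite insubF //; apply/negbTE; rewrite -leqNgt.
Qed.

(** Doubling the sum avoids a choice of representatives of the pairs of permutations; the factor 2
    is cancelled later. *)
Lemma symt_swap l c F t : (c.+1 < lam_upto lam l)%N ->
  2 * symt lam l F t = \sum_(p : 'S_(lam_upto lam l))
    (F (perm_level l p t) + F (swap_level l c (perm_level l p t))).
Proof.
move=> cl; rewrite big_split /= mulr_natl mulr2n; congr (_ + _).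
rewrite /symt (reindex_inj (mulgI (tperm (Ordinal (ltnW cl)) (Ordinal cl)))).
by apply: eq_bigr => p _; rewrite -swap_level_perm.
Qed.

Lemma perm_level_swap l k c m (p : 'S_m) t : l != k ->
  perm_level l p (swap_level k c t) = swap_level k c (perm_level l p t).
Proof.
move=> lk; have kl : (k == l) = false by rewrite eq_sym (negbTE lk).
apply/funext => j; apply/funext => a; rewrite /perm_level /swap_level (negbTE lk) kl.
by have [->|//] := eqVneq j l; rewrite (negbTE lk).
Qed.

End LevelRecursion.

(** * Positions in a level and elements of a level *)

Section Ranks.
Context {n : nat}.
Implicit Types (S : {set 'I_n}) (e f : 'I_n).

Definition rank S e := #|[set f in S | (f < e)%N]|.

Lemma index_count_ltn (s : seq nat) x : sorted ltn s -> x \in s ->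
  index x s = count (fun y => y < x)%N s.
Proof.
elim: s => //= y s IH ys; rewrite inE.
have /allP ally : all (ltn y) s by apply: order_path_min ys => a b c; exact: ltn_trans.
have [<- _|yx] := eqVneq y x.
  rewrite ltnn add0n; apply/esym/eqP; rewrite -leqn0 leqNgt -has_count.
  by apply/hasPn => z /ally /= yz; rewrite -leqNgt ltnW.
rewrite /= => xs; have /= -> := ally _ xs.
by rewrite (IH (path_sorted ys) xs).
Qed.

Lemma sorted_enum S : sorted ltn [seq val e | e <- enum S].
Proof.
apply: (subseq_sorted (leT := ltn)); last exact: (iota_ltn_sorted 0 n).
  by move=> a b c; exact: ltn_trans.
rewrite -val_enum_ord map_subseq // enumT /enum_mem.
exact: filter_subseq.
Qed.

Lemma rank_index S e : e \in S -> rank S e = index e (enum S).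
Proof.
move=> eS; rewrite -(index_map val_inj) index_count_ltn ?sorted_enum //; last first.
  by rewrite map_f // mem_enum.
rewrite count_map /rank cardE /enum_mem !size_filter /= count_filter.
by apply: eq_count => f; rewrite /= !inE andbC.
Qed.

Lemma rank_lt S e f : e \in S -> (e < f)%N -> (rank S e < rank S f)%N.
Proof.
move=> eS ef; apply/proper_card/properP; split.
  by apply/fintype.subsetP => g; rewrite !inE => /andP[-> ge] /=; exact: ltn_trans ef.
by exists e; rewrite !inE ?eS ?ef // ltnn andbF.
Qed.

Lemma ltn_rank S e f : e \in S -> f \in S -> (rank S e < rank S f)%N = (e < f)%N.
Proof.
move=> eS fS; case: (ltngtP e f) => [ef|fe|/val_inj ->]; last by rewrite ltnn.
  by rewrite rank_lt.
by apply/negbTE; rewrite -leqNgt ltnW // rank_lt.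
Qed.

Lemma rank_inj S e f : e \in S -> f \in S -> rank S e = rank S f -> e = f.
Proof.
move=> eS fS r; apply: val_inj; case: (ltngtP (val e) (val f)) => // ef.
  by have := rank_lt eS ef; rewrite r ltnn.
by have := rank_lt fS ef; rewrite r ltnn.
Qed.

Lemma rank_bound S e : e \in S -> (rank S e < #|S|)%N.
Proof. by move=> eS; rewrite rank_index // cardE index_mem mem_enum. Qed.

Lemma prod_rank (T : comPzSemiRingType) S (F : nat -> T) :
  \prod_(a < #|S|) F a = \prod_(e in S) F (rank S e).
Proof.
rewrite -(big_mkord xpredT F).
have [->|[e0 _]] := set_0Vmem S; first by rewrite cards0 big_geq // big_set0.
rewrite -[RHS]big_enum /= (big_nth e0) cardE.
apply: eq_big_nat => a /andP[_ al].
have mS : nth e0 (enum S) a \in S by rewrite -mem_enum mem_nth.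
by rewrite rank_index // index_uniq // enum_uniq.
Qed.

End Ranks.

(** * Level factors indexed by elements, so that a transposition acts by reindexing *)

Section Elementwise.
Context {R : realType} {n N : nat}.
Variables (tau : R[i]) (lam : 'I_N -> nat) (h : R[i]) (mu : 'I_N -> R[i]).
Implicit Types (J : 'I_N -> {set 'I_n}) (t : nat -> nat -> R[i]).
Implicit Types (e f : 'I_n) (v w : 'I_n -> R[i]).
Local Notation th := (theta tau).

Definition lev J l : {set 'I_n} := \bigcup_(j < N | (j < l)%N) J j.

Definition at_rank J l t e := t l (rank (lev J l) e).

Definition blk J (k : 'I_N) e : 'I_N := odflt k [pick j | e \in J j].

Definition shift_at J (k : 'I_N) e : R[i] :=
  h *~ (1 + (pcount J (blk J k e) e)%:Z - (pcount J k e)%:Z) + mu k - mu (blk J k e).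

Definition psi_at J (k : 'I_N) e f x : R[i] :=
  if (f < e)%N then th (h + x) else if (e < f)%N then th x
  else th (x + shift_at J k e) / th (shift_at J k e).

Definition self_at v e f : R[i] := th (h + v f - v e) / th (v f - v e).

Definition U_elt J (k : 'I_N) v w : R[i] :=
  (\prod_(p | (p.1 \in lev J k) && (p.2 \in lev J k.+1))
     psi_at J k p.1 p.2 (w p.2 - v p.1)) *
  \prod_(p | (p.1 \in lev J k) && (p.2 \in lev J k) && (p.1 < p.2)%N)
     self_at v p.1 p.2.

Lemma U_elt_ext J (k : 'I_N) v v' w w' : {in lev J k, v =1 v'} -> {in lev J k.+1, w =1 w'} ->
  U_elt J k v w = U_elt J k v' w'.
Proof.
move=> Hv Hw; rewrite /U_elt.
congr (_ * _); apply: eq_bigr => -[e f] /=.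
  by move=> /andP[e1 f1]; rewrite (Hv e) // (Hw f).
by move=> /andP[/andP[e1 f1] _]; rewrite /self_at !Hv.
Qed.

Section Partition.
Context (J : 'I_N -> {set 'I_n}) (partJ : ordered_partition lam J).

Lemma part_uniq e j k : e \in J j -> e \in J k -> j = k.
Proof.
have [_ dJ _] := partJ; move=> ej ek; apply/eqP; apply: contraTT ek => /dJ.
by rewrite disjoint_subset => /fintype.subsetP /(_ e ej).
Qed.

Lemma card_lev l : #|lev J l| = lam_upto lam l.
Proof.
have [cJ _ _] := partJ; rewrite /lev /lam_upto.
rewrite -sum1_card (eq_bigr (fun j => \sum_(e in J j) 1)%N) => [|j _]; last first.
  by rewrite sum1_card cJ.
rewrite (exchange_big_dep xpredT) //= big_mkcond /=; apply: eq_bigr => e _.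
case: bigcupP => [[j jl ej]|ne].
  rewrite (big_pred1 j) // => k /=; apply/andP/eqP => [[_ ek]|-> //].
  exact: part_uniq ek ej.
by rewrite big_pred0 // => k; apply/negbTE/andP => -[kl ek]; apply: ne; exists k.
Qed.

Lemma mem_lev e j l : e \in J j -> (e \in lev J l) = (j < l)%N.
Proof.
move=> ej; apply/bigcupP/idP => [[k kl ek]|jl]; last by exists j.
by rewrite (part_uniq ej ek).
Qed.

Lemma blkE e j (k : 'I_N) : e \in J j -> blk J k e = j.
Proof.
move=> ej; rewrite /blk; case: pickP => [k' ek'|/(_ j)]; last by rewrite ej.
exact: part_uniq ek' ej.
Qed.

Lemma psi_shiftE (k : 'I_N) a e : elt J k a = e -> psi_shift J k a h mu = shift_at J k e.
Proof.
move=> E; rewrite /psi_shift /shift_at; have -> : block_of J k a = blk J k e.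
  rewrite /block_of /blk E; congr odflt; apply: eq_pick => j.
  by rewrite mem_map ?mem_enum //; exact: val_inj.
by rewrite E.
Qed.

Lemma psi_ellE (k : 'I_N) a c e f x : elt J k a = e -> elt J k.+1 c = f ->
  psi_ell tau J k a c h mu x = psi_at J k e f x.
Proof. by move=> ea fc; rewrite /psi_ell /psi_at (psi_shiftE ea) ea fc. Qed.

Lemma prod_lev (T : comPzSemiRingType) l (F : nat -> T) :
  \prod_(a < lam_upto lam l) F a = \prod_(e in lev J l) F (rank (lev J l) e).
Proof. by rewrite -card_lev prod_rank. Qed.

Lemma elt_rank l e : e \in lev J l -> elt J l (rank (lev J l) e) = e.
Proof.
move=> el; rewrite /elt rank_index // (nth_map e) ?nth_index ?mem_enum //.
by rewrite index_mem mem_enum.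
Qed.

Lemma U_atE (k : 'I_N) t :
  U_at tau lam h mu J k t = U_elt J k (at_rank J k t) (at_rank J k.+1 t).
Proof.
rewrite /U_at /U_elt big_split /=; congr (_ * _).
  rewrite (prod_lev k (fun a => \prod_(c < lam_upto lam k.+1)
    psi_ell tau J k a c h mu (t k.+1 c - t k a))).
  under eq_bigr => e _ do rewrite (prod_lev k.+1
    (fun c => psi_ell tau J k (rank (lev J k) e) c h mu
      (t k.+1 c - t k (rank (lev J k) e)))).
  rewrite pair_big /=; apply: eq_bigr => -[e f] /= /andP[el fl].
  by apply: psi_ellE; exact: elt_rank.
under eq_bigr do rewrite big_mkcond /=.
rewrite (prod_lev k (fun a => \prod_(b < lam_upto lam k) if (a < b)%N then
   th (h + t k b - t k a) / th (t k b - t k a) else 1)).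
under eq_bigr => e _ do rewrite (prod_lev k (fun b => if (rank (lev J k) e < b)%N then
   th (h + t k b - t k (rank (lev J k) e)) / th (t k b - t k (rank (lev J k) e)) else 1))
   -big_mkcondr.
rewrite pair_big_dep /=; apply: eq_bigl => -[e f] /=.
by rewrite andbA; apply: andb_id2l => /andP[el fl]; rewrite ltn_rank.
Qed.

End Partition.
End Elementwise.


(** * The adjacent transposition *)

Section PermutedPartitions.
Context {n N : nat}.
Implicit Types (J : 'I_N -> {set 'I_n}).

Lemma partition_perm lam J (p : 'S_n) :
  ordered_partition lam J -> ordered_partition lam (perm_partition p J).
Proof.
have pI := @perm_inj _ p; move=> [cJ dJ uJ]; split=> [j|j k jk|].
- by rewrite card_imset.
- have := dJ j k jk; rewrite -!setI_eq0 -imsetI => [/eqP ->|? ? _ _]; last exact: pI.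
  by rewrite imset0.
apply/setP => e; rewrite inE.
have : (p^-1)%g e \in \bigcup_(j < N) J j by rewrite uJ inE.
move=> /bigcupP[j _ ej]; apply/bigcupP; exists j => //.
by rewrite -[e](permKV p) imset_f.
Qed.

Lemma perm_partitionM (p p' : 'S_n) J :
  perm_partition (p * p')%g J = perm_partition p' (perm_partition p J).
Proof.
apply/funext => j; rewrite /perm_partition -imset_comp.
by apply: eq_imset => e; rewrite permM.
Qed.

End PermutedPartitions.

Section AdjacentTransposition.
Context {n N : nat} (i i1 : 'I_n) (i1E : i1 = i.+1 :> nat).
Implicit Types (J : 'I_N -> {set 'I_n}) (e f : 'I_n) (A S : {set 'I_n}).
Local Notation s := (tperm i i1).
Local Notation sw := (perm_partition (N := N) s).

Definition in_pair e := (e == i) || (e == i1).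

Definition both_in_pair e f := in_pair e && in_pair f.

Lemma i_neq_i1 : i != i1.
Proof. by rewrite -val_eqE /= i1E; lia. Qed.

Lemma tperm_out e : ~~ in_pair e -> s e = e.
Proof. by rewrite negb_or => /andP[e1 e2]; rewrite tpermD // eq_sym. Qed.

Lemma in_pair_tperm e : in_pair (s e) = in_pair e.
Proof.
rewrite /in_pair; case: tpermP => [->|->|/eqP/negbTE -> /eqP/negbTE -> //];
  by rewrite !eqxx ?orbT.
Qed.

(** Adjacency: no third element separates [i] from [i1], so a comparison with one cannot distinguish
    them. *)
Lemma ltn_tperm_l e f : ~~ both_in_pair e f -> (s e < f)%N = (e < f)%N.
Proof.
rewrite /both_in_pair negb_and => /orP[e0|f0]; first by rewrite tperm_out.
move: f0; rewrite negb_or -!val_eqE /= => /andP[f0 f1].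
by case: tpermP => [->|->|//]; lia.
Qed.

Lemma ltn_tperm_r e f : ~~ both_in_pair e f -> (f < s e)%N = (f < e)%N.
Proof.
rewrite /both_in_pair negb_and => /orP[e0|f0]; first by rewrite tperm_out.
move: f0; rewrite negb_or -!val_eqE /= => /andP[f0 f1].
by case: tpermP => [->|->|//]; lia.
Qed.

Lemma ltn_tperm2 e f : ~~ both_in_pair e f -> (s e < s f)%N = (e < f)%N.
Proof.
move=> ef; rewrite ltn_tperm_l; last by rewrite /both_in_pair in_pair_tperm.
by rewrite ltn_tperm_r // /both_in_pair andbC.
Qed.

Lemma mem_swap A e : (e \in s @: A) = (s e \in A).
Proof. by rewrite -{1}(tpermK i i1 e) mem_imset //; exact: perm_inj. Qed.

Lemma swK J : sw (sw J) = J.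
Proof.
by apply/funext => j; apply/setP => e; rewrite /perm_partition !mem_swap tpermK.
Qed.

Lemma mem_lev_swap J l e : (e \in lev (sw J) l) = (s e \in lev J l).
Proof.
apply/bigcupP/bigcupP => -[j jl ej]; exists j => //; first by rewrite -mem_swap.
by rewrite /perm_partition mem_swap.
Qed.

Lemma lev_swap_both J l : i \in lev J l -> i1 \in lev J l -> lev (sw J) l = lev J l.
Proof.
move=> il i1l; apply/setP => e; rewrite mem_lev_swap.
by case: tpermP => [->|->|//]; rewrite il i1l.
Qed.

(** On a set that misses [i] or [i1] the transposition is increasing. *)
Lemma rank_swap S e : e \in S -> ~~ ((i \in S) && (i1 \in S)) ->
  rank (s @: S) (s e) = rank S e.
Proof.
move=> eS nb; rewrite /rank -[RHS](card_imset _ (@perm_inj _ s)).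
apply: eq_card => f; rewrite inE !mem_swap inE; apply: andb_id2l => fS.
have [<-|fe] := eqVneq (s f) e; first by rewrite tpermK !ltnn.
rewrite -{1}(tpermK i i1 f) ltn_tperm2 //; apply: contra nb.
rewrite /both_in_pair /in_pair => /andP[/orP[] /eqP fi /orP[] /eqP ei];
  by move: fS eS fe; rewrite fi ei ?eqxx // => -> ->.
Qed.

Lemma rank_succ S : i \in S -> rank S i1 = (rank S i).+1.
Proof.
move=> iS; rewrite /rank [RHS](_ : _ = #|i |: [set f in S | (f < i)%N]|).
  apply: eq_card => f; rewrite !inE i1E ltnS leq_eqVlt val_eqE.
  by case: eqVneq => [->|] //=; rewrite iS.
by rewrite cardsU1 inE ltnn andbF.
Qed.

Section Pcount.
Variables (J : 'I_N -> {set 'I_n}).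

Lemma pcount_swap_out j e : ~~ in_pair e -> pcount (sw J) j e = pcount J j e.
Proof.
move=> e0; rewrite /pcount -[RHS](card_imset _ (@perm_inj _ s)).
apply: eq_card => f; rewrite inE !mem_swap inE; apply: andb_id2l => _.
by rewrite ltn_tperm_l // /both_in_pair (negbTE e0) andbF.
Qed.

(** Elements below [i] are fixed by [s]; hence [J] and [sw J] have the same dynamical parameters at
    [i]. *)
Lemma pcount_swap_i j : pcount (sw J) j i = pcount J j i.
Proof.
rewrite /pcount; apply: eq_card => f; rewrite !inE mem_swap.
case: (tpermP i i1 f) => [->|->|//]; first by rewrite ltnn !andbF.
have -> : (i1 < i)%N = false by lia.
by rewrite !andbF.
Qed.

Lemma pcount_i1 j : pcount J j i1 = (pcount J j i + (i \in J j))%N.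
Proof.
case: (boolP (i \in J j)) => iJ; rewrite ?addn1 ?addn0; first exact: rank_succ.
apply: eq_card => f; rewrite !inE; apply: andb_id2l => fJ.
have : f != i by apply: contraNneq iJ => <-.
by rewrite -val_eqE /= i1E; lia.
Qed.

End Pcount.

End AdjacentTransposition.

(** * Separating the factors that involve both elements of the pair *)

Section LocalFactors.
Context {R : realType} {n N : nat}.
Variables (tau : R[i]) (lam : 'I_N -> nat) (h : R[i]) (mu : 'I_N -> R[i]).
Context (i i1 : 'I_n) (i1E : i1 = i.+1 :> nat).
Implicit Types (J : 'I_N -> {set 'I_n}) (t : nat -> nat -> R[i]).
Implicit Types (e f : 'I_n) (v w : 'I_n -> R[i]) (k : 'I_N).
Local Notation th := (theta tau).
Local Notation s := (tperm i i1).
Local Notation sw := (perm_partition (N := N) s).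
Local Notation both := (both_in_pair i i1).
Local Notation psi := (psi_at tau h mu).
Local Notation sft := (shift_at h mu).
Local Notation self := (self_at tau h).

Lemma psi_at_tperm_l J k e f x : ~~ both e f -> psi J k (s e) f x = psi J k e f x.
Proof.
move=> ef; rewrite /psi_at (ltn_tperm_r i1E ef) (ltn_tperm_l i1E ef).
case: (ltngtP f e) => [//|//|fe].
have e0 : ~~ in_pair i i1 e by move: ef; rewrite /both_in_pair (val_inj fe) andbb.
by rewrite (tperm_out e0).
Qed.

Lemma psi_at_tperm_r J k e f x : ~~ both e f -> psi J k e (s f) x = psi J k e f x.
Proof.
move=> ef; have fe : ~~ both f e by rewrite /both_in_pair andbC.
by rewrite /psi_at ltn_tperm_r // ltn_tperm_l.
Qed.

Lemma blk_swap J k e : blk (sw J) k (s e) = blk J k e.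
Proof.
rewrite /blk; congr odflt; apply: eq_pick => j.
by rewrite /perm_partition mem_swap tpermK.
Qed.

Lemma shift_at_swap_out J k e : ~~ in_pair i i1 e -> sft (sw J) k e = sft J k e.
Proof.
move=> e0; have := blk_swap J k e; rewrite tperm_out // => bE.
by rewrite /shift_at bE !pcount_swap_out.
Qed.

Lemma psi_at_swap J k e f x : ~~ both e f -> psi (sw J) k (s e) (s f) x = psi J k e f x.
Proof.
move=> ef; have ef' : ~~ both e (s f) by rewrite /both_in_pair in_pair_tperm.
rewrite (psi_at_tperm_l _ _ _ ef') (psi_at_tperm_r _ _ _ ef).
rewrite /psi_at; case: (ltngtP f e) => [//|//|fe].
have e0 : ~~ in_pair i i1 e by move: ef; rewrite /both_in_pair (val_inj fe) andbb.
by rewrite (shift_at_swap_out _ _ e0).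
Qed.

(* The factors of level [k] that involve [i] and [i1] only; [s] acts trivially
   on the product [rest_factor] of all the others. *)
Definition loc_factor J k v w : R[i] :=
  (\prod_(p | ((p.1 \in lev J k) && (p.2 \in lev J k.+1)) && both p.1 p.2)
     psi J k p.1 p.2 (w p.2 - v p.1)) *
  \prod_(p | ((p.1 \in lev J k) && (p.2 \in lev J k) && (p.1 < p.2)%N) && both p.1 p.2)
     self v p.1 p.2.

Definition rest_factor J k v w : R[i] :=
  (\prod_(p | ((p.1 \in lev J k) && (p.2 \in lev J k.+1)) && ~~ both p.1 p.2)
     psi J k p.1 p.2 (w p.2 - v p.1)) *
  \prod_(p | ((p.1 \in lev J k) && (p.2 \in lev J k) && (p.1 < p.2)%N) && ~~ both p.1 p.2)
     self v p.1 p.2.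

Lemma U_elt_split J k v w :
  U_elt tau h mu J k v w = loc_factor J k v w * rest_factor J k v w.
Proof.
rewrite /U_elt /loc_factor /rest_factor mulrACA.
by congr (_ * _); rewrite [LHS](bigID (fun p => both p.1 p.2)).
Qed.

(** Relabelling partition and variables together only permutes these factors. *)
Lemma rest_factor_swap J k v w :
  rest_factor (sw J) k (v \o s) (w \o s) = rest_factor J k v w.
Proof.
have inj : injective (fun p : 'I_n * 'I_n => (s p.1, s p.2)).
  by move=> [a b] [c d] [/perm_inj -> /perm_inj ->].
rewrite /rest_factor; apply: (congr2 *%R).
all: rewrite [LHS](reindex_inj inj).
all: rewrite /=.
  apply: eq_big => [[e f]|[e f]] /=.
    by rewrite !mem_lev_swap !tpermK /both_in_pair !in_pair_tperm.
  by rewrite /both_in_pair !in_pair_tperm !tpermK => /andP[_ ef]; rewrite psi_at_swap.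
apply: eq_big => [[e f]|[e f]] /=.
  rewrite !mem_lev_swap !tpermK /both_in_pair !in_pair_tperm.
  by apply: andb_id2r => ef; rewrite ltn_tperm2.
by rewrite /self_at /= !tpermK.
Qed.

(** With [J] kept, the [psi] product is reindexed in its first index alone: if just one element of a
    pair lies in [{i, i1}], its factor depends only on their order. *)
Lemma rest_factor_swap_below J k v w : i \in lev J k -> i1 \in lev J k ->
  rest_factor J k (v \o s) w = rest_factor J k v w.
Proof.
move=> ik i1k; have sE e : (s e \in lev J k) = (e \in lev J k).
  by case: tpermP => [->|->|//]; rewrite ik i1k.
have inj1 : injective (fun p : 'I_n * 'I_n => (s p.1, p.2)).
  by move=> [a b] [c d] [/perm_inj -> ->].
have inj : injective (fun p : 'I_n * 'I_n => (s p.1, s p.2)).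
  by move=> [a b] [c d] [/perm_inj -> /perm_inj ->].
rewrite /rest_factor; apply: (congr2 *%R).
  rewrite [LHS](reindex_inj inj1) /=; apply: eq_big => [[e f]|[e f]] /=.
    by rewrite sE /both_in_pair in_pair_tperm.
  by rewrite /both_in_pair !in_pair_tperm !tpermK => /andP[_ ef]; rewrite psi_at_tperm_l.
rewrite [LHS](reindex_inj inj) /=; apply: eq_big => [[e f]|[e f]] /=.
  rewrite !sE /both_in_pair !in_pair_tperm.
  by apply: andb_id2r => ef; rewrite ltn_tperm2.
by rewrite /self_at /= !tpermK.
Qed.

Lemma rest_factor_swap_above J k v w : i \in lev J k.+1 -> i1 \in lev J k.+1 ->
  rest_factor J k v (w \o s) = rest_factor J k v w.
Proof.
move=> ik i1k; have sE e : (s e \in lev J k.+1) = (e \in lev J k.+1).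
  by case: tpermP => [->|->|//]; rewrite ik i1k.
have inj2 : injective (fun p : 'I_n * 'I_n => (p.1, s p.2)).
  by move=> [a b] [c d] [-> /perm_inj ->].
rewrite /rest_factor; apply: (congr2 *%R); last by [].
rewrite [LHS](reindex_inj inj2) /=; apply: eq_big => [[e f]|[e f]] /=.
  by rewrite sE /both_in_pair in_pair_tperm.
by rewrite /both_in_pair !in_pair_tperm !tpermK => /andP[_ ef]; rewrite psi_at_tperm_r.
Qed.

Lemma prod_in_pair (P : pred 'I_n) (F : 'I_n -> R[i]) :
  \prod_(e | P e && in_pair i i1 e) F e =
  (if P i then F i else 1) * (if P i1 then F i1 else 1).
Proof.
have ni := i_neq_i1 i1E.
rewrite big_mkcondl (bigD1 i) /=; last by rewrite /in_pair eqxx.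
congr (_ * _); rewrite (big_pred1 i1) // => e; rewrite /in_pair /=.
apply/andP/eqP => [[/orP[/eqP ->|/eqP -> //]]|->]; first by rewrite eqxx.
by rewrite eqxx orbT eq_sym.
Qed.

Lemma loc_factorE J k v w : loc_factor J k v w =
  (if i \in lev J k then
     (if i \in lev J k.+1 then psi J k i i (w i - v i) else 1) *
     (if i1 \in lev J k.+1 then psi J k i i1 (w i1 - v i) else 1) else 1) *
  (if i1 \in lev J k then
     (if i \in lev J k.+1 then psi J k i1 i (w i - v i1) else 1) *
     (if i1 \in lev J k.+1 then psi J k i1 i1 (w i1 - v i1) else 1) else 1) *
  (if (i \in lev J k) && (i1 \in lev J k) then self v i i1 else 1).
Proof.
rewrite /loc_factor; congr (_ * _).
  transitivity (\prod_(e | (e \in lev J k) && in_pair i i1 e)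
    \prod_(f | (f \in lev J k.+1) && in_pair i i1 f) psi J k e f (w f - v e)).
    rewrite pair_big /=; apply: eq_bigl => -[e f] /=.
    by rewrite /both_in_pair andbACA.
  by rewrite prod_in_pair !(prod_in_pair (fun f => f \in lev J k.+1)).
transitivity (\prod_(e | (e \in lev J k) && in_pair i i1 e)
    \prod_(f | ((f \in lev J k) && (e < f)%N) && in_pair i i1 f) self v e f).
  rewrite pair_big_dep /=; apply: eq_bigl => -[e f] /=.
  by rewrite /both_in_pair -!andbA; do !bool_congr.
rewrite prod_in_pair !(prod_in_pair (fun f => (f \in lev J k) && (_ < f)%N)).
rewrite !ltnn !andbF !mul1r; have -> : (i < i1)%N by rewrite i1E.
have -> : (i1 < i)%N = false by rewrite i1E; lia.
by rewrite !andbF !andbT !mulr1; case: (i \in _); case: (i1 \in _); rewrite ?mulr1.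
Qed.

Lemma shift_at_i J k (a : 'I_N) : ordered_partition lam J -> i \in J a ->
  sft J k i = h + (mu_shift J i h mu k - mu_shift J i h mu a).
Proof.
move=> pJ ia; rewrite /shift_at (blkE pJ k ia) /mu_shift.
rewrite !mulrzDr mulr1z mulrNz -!pmulrn; ring.
Qed.

(** The counts below [i1] also count [i], whence the two corrections by [h]. *)
Lemma shift_at_i1 J k (b : 'I_N) : ordered_partition lam J -> i1 \in J b ->
  sft J k i1 = h + (mu_shift J i h mu k - mu_shift J i h mu b) +
               h *+ (i \in J b) - h *+ (i \in J k).
Proof.
move=> pJ i1b; rewrite /shift_at (blkE pJ k i1b) /mu_shift !(pcount_i1 i1E).
rewrite !mulrzDr mulr1z mulrNz -!pmulrn !mulrnDr; ring.
Qed.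

Lemma mu_shift_swap J : mu_shift (sw J) i h mu = mu_shift J i h mu.
Proof. by apply/funext => j; rewrite /mu_shift pcount_swap_i. Qed.

End LocalFactors.

(** * The exchange relation at every level *)

Section Exchange.
Context {R : realType} {n N : nat}.
Variables (tau : R[i]) (lam : 'I_N -> nat) (h : R[i]) (mu : 'I_N -> R[i]).
Context (i i1 : 'I_n) (i1E : i1 = i.+1 :> nat).
Implicit Types (J : 'I_N -> {set 'I_n}) (t : nat -> nat -> R[i]).
Implicit Types (e f : 'I_n) (v w : 'I_n -> R[i]) (k : 'I_N).
Local Notation th := (theta tau).
Local Notation s := (tperm i i1).
Local Notation sw := (perm_partition (N := N) s).
Local Notation psi := (psi_at tau h mu).
Local Notation sft := (shift_at h mu).
Local Notation W := (W_upto tau lam h mu).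
Local Notation rest := (rest_factor tau h mu i i1).
Local Notation loc := (loc_factor tau h mu i i1).

Lemma psi_self J k e x : psi J k e e x = th (x + sft J k e) / th (sft J k e).
Proof. by rewrite /psi_at ltnn. Qed.

Lemma psi_i_i1 J k x : psi J k i i1 x = th x.
Proof.
by rewrite /psi_at; case: ltngtP => [|//|]; rewrite i1E; lia.
Qed.

Lemma psi_i1_i J k x : psi J k i1 i x = th (x + h).
Proof. by rewrite /psi_at i1E ltnSn addrC. Qed.

Definition U_rank J k t := U_elt tau h mu J k (at_rank J k t) (at_rank J k.+1 t).

Lemma W_uptoS_rank J k t : ordered_partition lam J ->
  W J k.+1 t = symt lam k (fun t => W J k t * U_rank J k t) t.
Proof.
move=> pJ; rewrite W_uptoS; apply: eq_bigr => p _; congr (_ * _).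
rewrite (big_pred1 k) => [|j]; last by rewrite /= -val_eqE.
exact: U_atE.
Qed.

(** The two elements are neighbours in the level, so they hold the positions [c] and [c + 1]. *)
Lemma at_rank_swap_level J l t e (c := rank (lev J l) i) :
  i \in lev J l -> i1 \in lev J l -> e \in lev J l ->
  at_rank J l (swap_level l c t) e = at_rank J l t (s e).
Proof.
move=> il i1l el; rewrite /at_rank /swap_level eqxx; congr (t l _).
have rS := rank_succ i1E il.
case: tpermP => [->|->|ei ei1]; first by rewrite eqxx rS.
  by rewrite rS eqxx (gtn_eqF (ltnSn _)).
case: eqP => [/(rank_inj el il)//|_]; rewrite /c -rS.
by case: eqP => [/(rank_inj el i1l)|].
Qed.

Lemma at_rank_sw J l t e : ~~ ((i \in lev J l) && (i1 \in lev J l)) ->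
  e \in lev (sw J) l -> at_rank (sw J) l t e = at_rank J l t (s e).
Proof.
move=> nb; rewrite mem_lev_swap => el; rewrite /at_rank; congr (t l _).
have -> : lev (sw J) l = s @: lev J l.
  by apply/setP => f; rewrite mem_lev_swap mem_swap.
by rewrite -[in LHS](tpermK i i1 e) rank_swap.
Qed.

Lemma at_rank_sw_both J l t : i \in lev J l -> i1 \in lev J l ->
  at_rank (sw J) l t = at_rank J l t.
Proof. by move=> il i1l; apply/funext => e; rewrite /at_rank lev_swap_both. Qed.

Lemma at_rank_level J l t t' : t l = t' l -> at_rank J l t = at_rank J l t'.
Proof. by move=> E; apply/funext => e; rewrite /at_rank E. Qed.

Lemma swap_level_other l l' c t : l != l' -> swap_level l' c t l = t l.
Proof. by move=> ll; apply/funext => a; rewrite /swap_level (negbTE ll). Qed.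

Definition t_regular t := forall k (a b : 'I_(lam_upto lam k)), (0 < k)%N -> a != b ->
  th (t k b - t k a) != 0.

Lemma t_regular_perm k (p : 'S_(lam_upto lam k)) t :
  t_regular t -> t_regular (perm_level k p t).
Proof.
move=> H j a b j0 ab; rewrite /perm_level.
have [E|_] := eqVneq (j : nat) k; last exact: H.
have jk : j = k by exact: val_inj.
move: a b ab; rewrite jk => a b ab; rewrite !valK /=.
by apply: H; rewrite -?jk // (inj_eq perm_inj).
Qed.

Lemma U_both J (a b : 'I_N) k v w : ordered_partition lam J ->
  i \in J a -> i1 \in J b -> (a < k)%N -> (b < k)%N ->
  U_elt tau h mu J k v w =
  both_loc th h (sft J k i) (sft J k i1) (v i) (v i1) (w i) (w i1) * rest J k v w.
Proof.
move=> pJ ia i1b ak bk; rewrite (U_elt_split _ _ _ i i1) (loc_factorE _ _ _ i1E).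
rewrite !(mem_lev pJ _ ia) !(mem_lev pJ _ i1b) ak bk !ltnS (ltnW ak) (ltnW bk) /=.
rewrite !psi_self psi_i_i1 psi_i1_i /both_loc /self_at.
have -> : h + v i1 - v i = v i1 - v i + h by ring.
by rewrite !mulrA.
Qed.

Lemma at_rank_diff_neq0 J k t : ordered_partition lam J -> t_regular t -> (0 < k)%N ->
  i \in lev J k -> i1 \in lev J k -> th (at_rank J k t i - at_rank J k t i1) != 0.
Proof.
move=> pJ tr k0 ik i1k; have b0 := rank_bound ik; have b1 := rank_bound i1k.
rewrite (card_lev pJ) in b0 b1.
apply: (tr k (Ordinal b1) (Ordinal b0)) => //.
by rewrite -val_eqE /= (rank_succ i1E ik); lia.
Qed.

Lemma U_rank_swap_above J k t (c := rank (lev J k.+1) i) :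
  i \in lev J k.+1 -> i1 \in lev J k.+1 ->
  U_rank J k (swap_level k.+1 c t) =
  U_elt tau h mu J k (at_rank J k t) (at_rank J k.+1 t \o s).
Proof.
move=> ik i1k; apply: U_elt_ext => e el; last by rewrite at_rank_swap_level.
by rewrite (@at_rank_level _ _ _ t) // swap_level_other // ltn_eqF.
Qed.

Lemma U_rank_swap_below J k t (c := rank (lev J k) i) :
  i \in lev J k -> i1 \in lev J k ->
  U_rank J k (swap_level k c t) =
  U_elt tau h mu J k (at_rank J k t \o s) (at_rank J k.+1 t).
Proof.
move=> ik i1k; apply: U_elt_ext => e el; first by rewrite at_rank_swap_level.
by rewrite (@at_rank_level _ _ _ t) // swap_level_other // gtn_eqF.
Qed.

Lemma U_rank_swap_both J k t (c := rank (lev J k) i) (c' := rank (lev J k.+1) i) :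
  i \in lev J k -> i1 \in lev J k -> i \in lev J k.+1 -> i1 \in lev J k.+1 ->
  U_rank J k (swap_level k c (swap_level k.+1 c' t)) =
  U_elt tau h mu J k (at_rank J k t \o s) (at_rank J k.+1 t \o s).
Proof.
move=> ik i1k ik1 i1k1; rewrite U_rank_swap_below //; apply: U_elt_ext => e el.
  rewrite /=; congr (_ (s e)); apply: at_rank_level.
  by rewrite swap_level_other // ltn_eqF.
by rewrite at_rank_swap_level.
Qed.

Lemma W_upto_swap_above J l c t : W J l (swap_level l.+1 c t) = W J l t.
Proof. by apply: W_upto_ext => j jl; rewrite swap_level_other // ltn_eqF. Qed.

Lemma W_upto_swap_both J l c c' t :
  W J l (swap_level l c (swap_level l.+1 c' t)) = W J l (swap_level l c t).
Proof.
apply: W_upto_ext => j jl; apply/funext => d; rewrite /swap_level.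
have -> : (j == l.+1) = false by rewrite ltn_eqF.
by have -> : (l == l.+1) = false by rewrite ltn_eqF.
Qed.

(** * Both elements in the same block *)

Section OneBlock.
Hypothesis tau_gt0 : 0 < complex.Im tau.
Variables (J : 'I_N -> {set 'I_n}) (a : 'I_N).
Hypotheses (pJ : ordered_partition lam J) (ia : i \in J a) (i1a : i1 \in J a).
Hypothesis shreg : forall k e, (0 < k)%N -> e \in lev J k -> th (sft J k e) != 0.

Lemma sw_one_block : sw J = J.
Proof.
apply/funext => j; apply/setP => e; rewrite /perm_partition mem_swap.
have ij : (i \in J j) = (i1 \in J j).
  by apply/idP/idP => ej; [rewrite (part_uniq pJ ej ia)|rewrite (part_uniq pJ ej i1a)].
by case: tpermP => [->|->|//]; rewrite ij.
Qed.

Lemma W_upto_sym l t : (a < l <= N)%N -> t_regular t ->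
  W J l (swap_level l (rank (lev J l) i) t) = W J l t.
Proof.
move=> /andP[al lN]; elim: l al lN t => [//|l IH] al lN t tr.
pose k := Ordinal lN; rewrite -[l]/(k : nat) in al IH *.
have ik1 : i \in lev J k.+1 by rewrite (mem_lev pJ _ ia).
have i1k1 : i1 \in lev J k.+1 by rewrite (mem_lev pJ _ i1a).
rewrite !(W_uptoS_rank _ _ pJ).
have kk : (k : nat) != k.+1 by rewrite ltn_eqF.
(* At [k = a] the lower level contains neither element, so there is no local factor and each summand
   is already symmetric. *)
move: al; rewrite ltnS leq_eqVlt => /orP[/eqP ak|ak].
  apply: eq_bigr => p _; rewrite (perm_level_swap _ _ _ kk) W_upto_swap_above.
  rewrite (@U_rank_swap_above _ _ _ ik1 i1k1); apply: (congr2 *%R); first by [].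
  rewrite /U_rank !(U_elt_split _ _ _ i i1) !(loc_factorE _ _ _ i1E).
  rewrite (rest_factor_swap_above _ _ _ i1E _ _ ik1 i1k1).
  by rewrite (mem_lev pJ k ia) (mem_lev pJ k i1a) ak ltnn.
have ik : i \in lev J k by rewrite (mem_lev pJ _ ia).
have i1k : i1 \in lev J k by rewrite (mem_lev pJ _ i1a).
have k0 : (0 < k)%N by apply: leq_ltn_trans ak.
have ck : ((rank (lev J k) i).+1 < lam_upto lam k)%N.
  by rewrite -(rank_succ i1E ik) -(card_lev pJ) rank_bound.
have two0 : (2 : R[i]) != 0 by rewrite pnatr_eq0.
apply: (mulfI two0); rewrite !(symt_swap _ _ ck); apply: eq_bigr => p _.
rewrite (perm_level_swap _ _ _ kk); set T := perm_level k p t.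
have Tr : t_regular T by exact: t_regular_perm.
rewrite W_upto_swap_above W_upto_swap_both (IH ak (ltnW lN) T Tr) -!mulrDr.
apply: (congr2 *%R); first by [].
rewrite (U_rank_swap_above _ ik1 i1k1) (U_rank_swap_both _ ik i1k ik1 i1k1).
rewrite (U_rank_swap_below _ ik i1k).
rewrite /U_rank !(U_both _ _ pJ ia i1a ak ak) /= tpermL tpermR.
rewrite !(rest_factor_swap_above _ _ _ i1E _ _ ik1 i1k1).
rewrite !(rest_factor_swap_below _ _ _ i1E _ _ ik i1k).
(* [i] counts towards its own block at [i1], so the second shift exceeds the first by [h], as
   [both_loc_sym] requires. *)
have sE : sft J k i1 = sft J k i + h.
  rewrite (shift_at_i _ _ _ pJ ia) (shift_at_i1 _ _ i1E _ pJ i1a) ia.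
  suff -> : (i \in J k) = false by rewrite mulr1n mulr0n; ring.
  by apply/negP => iJk; move: ak; rewrite (part_uniq pJ ia iJk) ltnn.
have A0 : th (sft J k i + h) != 0 by rewrite -sE shreg.
have x0 := at_rank_diff_neq0 pJ Tr k0 ik i1k.
rewrite sE; move: (at_rank J k T) x0 => v x0; move: (at_rank J k.+1 T) => w.
move: (rest _ _ _ _) => ro; move: (sft J k i) A0 => A A0.
have E := both_loc_sym (@theta_odd _ tau) (theta_three_term_shifted tau_gt0)
  (w i) (w i1) x0 A0.
move: E; move: (both_loc _ _ _ _ (v i) (v i1) (w i1) (w i)) => e1.
move: (both_loc _ _ _ _ (v i1) (v i) (w i1) (w i)) => e2.
move: (both_loc _ _ _ _ (v i) (v i1) (w i) (w i1)) => e3.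
move: (both_loc _ _ _ _ (v i1) (v i) (w i) (w i1)) => e4 E.
by rewrite -!mulrDl E.
Qed.

End OneBlock.

End Exchange.

(** * The two elements in different blocks *)

Section ExchangeTwoBlocks.
Context {R : realType} {n N : nat}.
Variables (tau : R[i]) (lam : 'I_N -> nat) (h : R[i]) (mu : 'I_N -> R[i]).
Context (tau_gt0 : 0 < complex.Im tau).
Context (i i1 : 'I_n) (i1E : i1 = i.+1 :> nat).
Implicit Types (J : 'I_N -> {set 'I_n}) (t : nat -> nat -> R[i]).
Implicit Types (e f : 'I_n) (v w : 'I_n -> R[i]) (k : 'I_N).
Local Notation th := (theta tau).
Local Notation s := (tperm i i1).
Local Notation sw := (perm_partition (N := N) s).
Local Notation psi := (psi_at tau h mu).
Local Notation sft := (shift_at h mu).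
Local Notation W := (W_upto tau lam h mu).
Local Notation rest := (rest_factor tau h mu i i1).
Local Notation loc := (loc_factor tau h mu i i1).

Local Notation tregular := (t_regular tau lam).
Local Notation Urank := (U_rank tau h mu).

Section TwoBlocks.
Variables (J : 'I_N -> {set 'I_n}) (a b : 'I_N).
Hypotheses (pJ : ordered_partition lam J) (ia : i \in J a) (i1b : i1 \in J b).
Hypothesis ab : (a < b)%N.
Hypothesis shreg : forall k e, (0 < k)%N -> e \in lev J k -> th (sft J k e) != 0.

(** [cc] is the diagonal R-matrix entry for [a < b] without the factor [th x / th (x + h)]; in the
    opposite direction this coefficient is 1. *)
Local Notation M := (mu_shift J i h mu).
Local Notation D := (M b - M a).
Local Notation cc := (th (h + D) * th (h - D) / (th D * th (- D))).

Let pJ' : ordered_partition lam (sw J).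
Proof. exact: partition_perm. Qed.
Let ib' : i \in sw J b. Proof. by rewrite /perm_partition mem_swap tpermL. Qed.
Let i1a' : i1 \in sw J a. Proof. by rewrite /perm_partition mem_swap tpermR. Qed.

Let ib0 : (i \in J b) = false.
Proof. by apply/negP => /(part_uniq pJ ia) E; move: ab; rewrite E ltnn. Qed.

Let sfti k : sft J k i = h + (M k - M a).
Proof. exact: (shift_at_i h mu k pJ ia). Qed.
Let sfti' k : sft (sw J) k i = h + (M k - M b).
Proof. by rewrite (shift_at_i _ _ _ pJ' ib') mu_shift_swap. Qed.
Let sfti1 k : (k != a) -> sft J k i1 = h + (M k - M b).
Proof.
move=> ka; rewrite (shift_at_i1 _ _ i1E _ pJ i1b) ib0 mulr0n addr0.
suff -> : (i \in J k) = false by rewrite mulr0n subr0.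
by apply/negP => /(part_uniq pJ ia) E; rewrite E eqxx in ka.
Qed.
(** For [k = b] the element [i], which [sw J] puts in block [b], is among those counted and cancels
    the summand 1 of the exponent of [h]. *)
Let sfti1' k : sft (sw J) k i1 = h *+ (k != b) + (M k - M a).
Proof.
rewrite (shift_at_i1 _ _ i1E _ pJ' i1a') mu_shift_swap //.
have -> : (i \in sw J a) = false.
  by apply/negP => /(part_uniq pJ' ib') E; move: ab; rewrite E ltnn.
rewrite mulr0n addr0; have -> : (i \in sw J k) = (k == b).
  by apply/idP/eqP => [/(part_uniq pJ' ib')|->].
by case: eqP => _ /=; rewrite ?mulr1n ?mulr0n; ring.
Qed.

(** Up to level [b] only the element of block [a] is present. It is called [i] in [J] and [i1] in
    [sw J], but it has the same position and the same shift. *)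
Lemma W_upto_below l t : (l <= b)%N -> W (sw J) l t = W J l t.
Proof.
elim: l t => [//|l IH] t lb; have lN : (l < N)%N by apply: ltn_trans lb _.
pose k := Ordinal lN; rewrite -[l]/(k : nat) in lb IH *.
rewrite (W_uptoS_rank _ _ _ _ _ pJ') (W_uptoS_rank _ _ _ _ _ pJ).
apply: eq_bigr => p _; rewrite (IH _ (ltnW lb)); apply: (congr2 *%R); first by [].
set T := perm_level _ _ _; rewrite /U_rank.
set v := at_rank J k T; set w := at_rank J k.+1 T.
have nb j : (j <= b)%N -> ~~ ((i \in lev J j) && (i1 \in lev J j)).
  by move=> jb; rewrite (mem_lev pJ _ i1b) ltnNge jb andbF.
have -> : U_elt tau h mu (sw J) k (at_rank (sw J) k T) (at_rank (sw J) k.+1 T) =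
          U_elt tau h mu (sw J) k (v \o s) (w \o s).
  by apply: U_elt_ext => e el; rewrite at_rank_sw // nb // ltnW.
rewrite !(U_elt_split _ _ _ i i1) (rest_factor_swap _ _ _ i1E).
apply: (congr2 *%R); last by [].
rewrite !(loc_factorE _ _ _ i1E) !(mem_lev pJ' _ ib') !(mem_lev pJ' _ i1a').
rewrite !(mem_lev pJ _ ia) !(mem_lev pJ _ i1b) !ltnS.
have -> : (b < k)%N = false by lia.
have -> : (b <= k)%N = false by lia.
have -> : psi (sw J) k i1 i1 ((w \o s) i1 - (v \o s) i1) = psi J k i i (w i - v i).
  rewrite !psi_self sfti sfti1' /= tpermR.
  by have -> : k != b by rewrite -val_eqE /= ltn_eqF.
move: (psi J k i i _) => y; rewrite !andbF; case: (ltnP a k) => ak.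
  by rewrite (ltnW ak) !mul1r !mulr1.
by rewrite !mulr1.
Qed.

(* The denominator [th (x + h)] of the R-matrix is multiplied out because it may
   vanish for the variables of an intermediate level. *)
Definition exchange_at l (V1 V2 : (nat -> nat -> R[i]) -> R[i]) (c d : R[i]) :=
  forall t, tregular t ->
  let r := rank (lev J l) i in
  let x := t l r - t l r.+1 in
  th (x + h) * V2 (swap_level l r t) = c * th x * V1 t + th (x + d) * th h / th d * V2 t.

(** Level [b] holds one element of the pair and [W_upto_below] gives both functions the same lower
    part, so the relation holds for each permutation separately, without pairing. *)
Lemma exchange_base : th D != 0 ->
  exchange_at b.+1 (W J b.+1) (W (sw J) b.+1) cc D /\
  exchange_at b.+1 (W (sw J) b.+1) (W J b.+1) 1 (- D).
Proof.
move=> D0; have b0 : (0 < b)%N by apply: leq_ltn_trans ab.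
have ib1 : i \in lev J b by rewrite (mem_lev pJ _ ia).
have ik1 : i \in lev J b.+1 by rewrite (mem_lev pJ _ ia) ltnS ltnW.
have i1k1 : i1 \in lev J b.+1 by rewrite (mem_lev pJ _ i1b).
have levE : lev (sw J) b.+1 = lev J b.+1 by exact: lev_swap_both.
have [ik1' i1k1'] : i \in lev (sw J) b.+1 /\ i1 \in lev (sw J) b.+1 by rewrite levE.
have hD0 : th (h + D) != 0 by rewrite -sfti; exact: shreg.
have bb : (b : nat) != b.+1 by rewrite ltn_eqF.
have nb : ~~ ((i \in lev J b) && (i1 \in lev J b)).
  by rewrite (mem_lev pJ _ i1b) ltnn andbF.
pose v (T : nat -> nat -> R[i]) := at_rank J b T.
pose w (T : nat -> nat -> R[i]) := at_rank J b.+1 T.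
pose r := rank (lev J b.+1) i.
pose rho T := rest J b (v T) (w T).
have UJ T w' : U_elt tau h mu J b (v T) w' =
    th (w' i - v T i + (h + D)) / th (h + D) * th (w' i1 - v T i) * rest J b (v T) w'.
  rewrite (U_elt_split _ _ _ i i1) (loc_factorE _ _ _ i1E) ib1 ik1 i1k1.
  by rewrite (mem_lev pJ _ i1b) ltnn !mulr1 psi_self (psi_i_i1 _ _ _ i1E) sfti.
have Usw T w' : U_elt tau h mu (sw J) b (v T \o s) w' =
    th (w' i - v T i + h) * (th (w' i1 - v T i + D) / th D) * rest (sw J) b (v T \o s) w'.
  rewrite (U_elt_split _ _ _ i i1) (loc_factorE _ _ _ i1E) levE ik1 i1k1.
  rewrite (mem_lev pJ' _ ib') (mem_lev pJ' _ i1a') ltnn ab mul1r mulr1.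
  by rewrite psi_self (psi_i1_i _ _ _ i1E) sfti1' eqxx mulr0n add0r /= tpermR.
have rhosw T : rest (sw J) b (v T \o s) (w T \o s) = rho T by exact: rest_factor_swap.
have rhosw' T : rest (sw J) b (v T \o s) (w T) = rho T.
  by rewrite -rhosw rest_factor_swap_above ?levE.
have rhoJ T : rest J b (v T) (w T \o s) = rho T by exact: rest_factor_swap_above.
have U1 T : Urank J b T = th (w T i - v T i + (h + D)) / th (h + D) *
    th (w T i1 - v T i) * rho T by exact: UJ.
have U2 T : Urank J b (swap_level b.+1 r T) = th (w T i1 - v T i + (h + D)) / th (h + D) *
    th (w T i - v T i) * rho T.
  by rewrite (U_rank_swap_above _ _ _ i1E _ ik1 i1k1) UJ rhoJ /= tpermL tpermR.
have vsw T : U_elt tau h mu (sw J) b (at_rank (sw J) b T) =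
             U_elt tau h mu (sw J) b (v T \o s).
  apply/funext => w'; apply: U_elt_ext => e el //=.
  by rewrite at_rank_sw.
have U3 T : Urank (sw J) b T =
    th (w T i - v T i + h) * (th (w T i1 - v T i + D) / th D) * rho T.
  by rewrite /U_rank vsw (at_rank_sw_both _ ik1 i1k1) Usw rhosw'.
have U4 T : Urank (sw J) b (swap_level b.+1 r T) =
    th (w T i1 - v T i + h) * (th (w T i - v T i + D) / th D) * rho T.
  have rE : r = rank (lev (sw J) b.+1) i by rewrite levE.
  rewrite rE (U_rank_swap_above _ _ _ i1E _ ik1' i1k1') vsw (at_rank_sw_both _ ik1 i1k1).
  rewrite Usw rhosw.
  by rewrite /= tpermL tpermR.
have xE p t : t b.+1 r - t b.+1 r.+1 = w (perm_level b p t) i - w (perm_level b p t) i1.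
  rewrite /w /at_rank /perm_level gtn_eqF // (rank_succ i1E) //.
have thN := @theta_odd _ tau; have th3 := theta_three_term_shifted tau_gt0.
have Wb T : W (sw J) b T = W J b T by exact: W_upto_below.
split=> t _; cbv zeta;
  rewrite !(W_uptoS_rank _ _ _ _ _ pJ) !(W_uptoS_rank _ _ _ _ _ pJ')
    /symt !mulr_sumr -big_split /=;
  apply: eq_bigr => p _; rewrite (perm_level_swap _ _ _ bb) W_upto_swap_above -/r (xE _ p t);
  set T := perm_level _ _ _; rewrite !Wb.
  rewrite U4 U1 U3; move: (w T i) (w T i1) (v T i) (W J b T) (rho T) => y1 y2 x f ro.
  have := one_num_exchange th3 h D x y1 y2; rewrite thN => E.
  apply/eqP; rewrite -subr_eq0; apply/eqP.
  transitivity (f * ro / th D ^+ 2 * 0); last by rewrite mulr0.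
  by rewrite -[in RHS]E; field; rewrite D0 hD0.
rewrite U2 U1 U3; move: (w T i) (w T i1) (v T i) (W J b T) (rho T) => y1 y2 x f ro.
have := one_num_exchange2 thN th3 h D x y1 y2; rewrite thN => E.
apply/eqP; rewrite -subr_eq0; apply/eqP.
transitivity (f * ro / (th D * th (h + D)) * 0); last by rewrite mulr0.
by rewrite -[in RHS]E; field; rewrite D0 hD0.
Qed.

Lemma exchange_step k : (b < k)%N -> th D != 0 ->
  exchange_at k (W J k) (W (sw J) k) cc D /\
  exchange_at k (W (sw J) k) (W J k) 1 (- D) ->
  exchange_at k.+1 (W J k.+1) (W (sw J) k.+1) cc D /\
  exchange_at k.+1 (W (sw J) k.+1) (W J k.+1) 1 (- D).
Proof.
move=> bk D0 [IH1 IH2].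
have ak : (a < k)%N by exact: ltn_trans bk.
have k0 : (0 < k)%N by apply: leq_ltn_trans ak.
have kk : (k : nat) != k.+1 by rewrite ltn_eqF.
have [ka kb] : k != a /\ k != b by rewrite -!val_eqE /= !gtn_eqF.
have ik : i \in lev J k by rewrite (mem_lev pJ _ ia).
have i1k : i1 \in lev J k by rewrite (mem_lev pJ _ i1b).
have ik1 : i \in lev J k.+1 by rewrite (mem_lev pJ _ ia) ltnS ltnW.
have i1k1 : i1 \in lev J k.+1 by rewrite (mem_lev pJ _ i1b) ltnS ltnW.
have levE : lev (sw J) k = lev J k by exact: lev_swap_both.
have levE1 : lev (sw J) k.+1 = lev J k.+1 by exact: lev_swap_both.
have [ik' i1k'] : i \in lev (sw J) k /\ i1 \in lev (sw J) k by rewrite levE.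
have [ik1' i1k1'] : i \in lev (sw J) k.+1 /\ i1 \in lev (sw J) k.+1 by rewrite levE1.
(* The shifts at [i] and [i1] are [A, B] for [J] and [B, A] for [sw J]; their difference does not
   depend on the level. *)
pose A := h + (M k - M a); pose B := h + (M k - M b).
have AB : A - B = D by rewrite /A /B; ring.
have BA : B - A = - D by rewrite /A /B; ring.
have A0 : th A != 0 by rewrite /A -sfti; exact: shreg.
have B0 : th B != 0 by rewrite /B -sfti1 //; exact: shreg.
pose v (T : nat -> nat -> R[i]) := at_rank J k T.
pose w (T : nat -> nat -> R[i]) := at_rank J k.+1 T.
pose r := rank (lev J k) i; pose r' := rank (lev J k.+1) i.
pose rho T := rest J k (v T) (w T).
have UJ v' w' : U_elt tau h mu J k v' w' =
    both_loc th h A B (v' i) (v' i1) (w' i) (w' i1) * rest J k v' w'.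
  by rewrite (U_both _ _ _ i1E _ _ pJ ia i1b ak bk) sfti (sfti1 ka).
have Usw v' w' : U_elt tau h mu (sw J) k v' w' =
    both_loc th h B A (v' i) (v' i1) (w' i) (w' i1) * rest (sw J) k v' w'.
  by rewrite (U_both _ _ _ i1E _ _ pJ' ib' i1a' bk ak) sfti' sfti1' kb mulr1n.
have rv J' v' w' : lev J' k = lev J k -> rest J' k (v' \o s) w' = rest J' k v' w'.
  by move=> E; apply: (rest_factor_swap_below _ _ _ i1E); rewrite E.
have rw J' v' w' : lev J' k.+1 = lev J k.+1 -> rest J' k v' (w' \o s) = rest J' k v' w'.
  by move=> E; apply: (rest_factor_swap_above _ _ _ i1E); rewrite E.
have rsw v' w' : rest (sw J) k v' w' = rest J k v' w'.
  by rewrite -(rv _ v' _ levE) -(rw _ _ w' levE1) (rest_factor_swap _ _ _ i1E).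
have rE : r = rank (lev (sw J) k) i by rewrite levE.
have rE' : r' = rank (lev (sw J) k.+1) i by rewrite levE1.
pose LJ T x1 x2 y1 y2 := both_loc th h A B x1 x2 y1 y2 * rho T.
pose Ls T x1 x2 y1 y2 := both_loc th h B A x1 x2 y1 y2 * rho T.
have UJ0 T : Urank J k T = LJ T (v T i) (v T i1) (w T i) (w T i1) by exact: UJ.
have UJ1 T : Urank J k (swap_level k r T) = LJ T (v T i1) (v T i) (w T i) (w T i1).
  by rewrite (U_rank_swap_below _ _ _ i1E _ ik i1k) UJ (rv _ _ _ erefl) /= tpermL tpermR.
have UJ2 T : Urank J k (swap_level k.+1 r' T) = LJ T (v T i) (v T i1) (w T i1) (w T i).
  by rewrite (U_rank_swap_above _ _ _ i1E _ ik1 i1k1) UJ (rw _ _ _ erefl) /= tpermL tpermR.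
have UJ3 T : Urank J k (swap_level k r (swap_level k.+1 r' T)) =
    LJ T (v T i1) (v T i) (w T i1) (w T i).
  by rewrite (U_rank_swap_both _ _ _ i1E _ ik i1k ik1 i1k1)
    UJ (rw _ _ _ erefl) (rv _ _ _ erefl) /= !tpermL !tpermR.
have Us0 T : Urank (sw J) k T = Ls T (v T i) (v T i1) (w T i) (w T i1).
  by rewrite /U_rank
    (at_rank_sw_both _ ik i1k) (at_rank_sw_both _ ik1 i1k1) Usw rsw.
have Us1 T : Urank (sw J) k (swap_level k r T) = Ls T (v T i1) (v T i) (w T i) (w T i1).
  rewrite rE (U_rank_swap_below _ _ _ i1E _ ik' i1k')
    (at_rank_sw_both _ ik i1k) (at_rank_sw_both _ ik1 i1k1) Usw rsw (rv _ _ _ erefl) /=.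
  by rewrite tpermL tpermR.
have Us2 T : Urank (sw J) k (swap_level k.+1 r' T) = Ls T (v T i) (v T i1) (w T i1) (w T i).
  rewrite rE' (U_rank_swap_above _ _ _ i1E _ ik1' i1k1')
    (at_rank_sw_both _ ik i1k) (at_rank_sw_both _ ik1 i1k1) Usw rsw (rw _ _ _ erefl) /=.
  by rewrite tpermL tpermR.
have Us3 T : Urank (sw J) k (swap_level k r (swap_level k.+1 r' T)) =
    Ls T (v T i1) (v T i) (w T i1) (w T i).
  rewrite rE rE' (U_rank_swap_both _ _ _ i1E _ ik' i1k' ik1' i1k1')
    (at_rank_sw_both _ ik i1k) (at_rank_sw_both _ ik1 i1k1) Usw rsw
    (rw _ _ _ erefl) (rv _ _ _ erefl) /=.
  by rewrite !tpermL !tpermR.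
have xE p t : t k.+1 r' - t k.+1 r'.+1 = w (perm_level k p t) i - w (perm_level k p t) i1.
  by rewrite /w /at_rank /perm_level gtn_eqF // (rank_succ i1E).
have vE (T : nat -> nat -> R[i]) : T k r - T k r.+1 = v T i - v T i1.
  by rewrite /v /at_rank (rank_succ i1E).
have thN := @theta_odd _ tau; have th3 := theta_three_term_shifted tau_gt0.
have two0 : (2 : R[i]) != 0 by rewrite pnatr_eq0.
have ck : (r.+1 < lam_upto lam k)%N.
  by rewrite -(rank_succ i1E ik) -(card_lev pJ) rank_bound.
have ccE : cc * 1 * th D ^+ 2 = - (th (h + D) * th (h - D)).
  by rewrite thN; field.
have ccE' : 1 * cc * th (- D) ^+ 2 = - (th (h - D) * th (h + D)).
  by rewrite thN; field.
have ND0 : th (- D) != 0 by rewrite thN oppr_eq0.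
split=> t tr; cbv zeta;
  rewrite !(W_uptoS_rank _ _ _ _ _ pJ) !(W_uptoS_rank _ _ _ _ _ pJ')
    -/r'; apply: (mulfI two0);
  rewrite mulrDr ![2 * (_ * symt _ _ _ _)]mulrCA !(symt_swap _ _ ck) !mulr_sumr -big_split /=;
  apply: eq_bigr => p _; rewrite (perm_level_swap _ _ _ kk) (xE _ p t);
  set T := perm_level _ _ _;
  have Tr : tregular T by exact: t_regular_perm.
  rewrite W_upto_swap_above W_upto_swap_both Us3 Us2 Us1 Us0 UJ1 UJ0 /LJ /Ls.
  have := IH1 T Tr; have := IH2 T Tr; cbv zeta; rewrite -/r vE.
  have := at_rank_diff_neq0 i1E pJ Tr k0 ik i1k; rewrite -/(v T).
  move: (W J k T) (W (sw J) k T) (W J k (swap_level k r T)) (W (sw J) k (swap_level k r T)).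
  move: (w T i) (w T i1) (v T i) (v T i1) (rho T) => y1 y2 x1 x2 ro f g fs gs x0 H2 H1.
  have := @both_loc_exchange _ th thN th3 h x1 x2 y1 y2 A B f fs g gs cc 1.
  cbv zeta; rewrite AB => /(_ A0 B0 D0 x0 ccE H1 H2) E.
  transitivity (th (y1 - y2 + h) * (g * both_loc th h B A x1 x2 y2 y1 +
    gs * both_loc th h B A x2 x1 y2 y1) * ro); first by ring.
  by rewrite E; ring.
rewrite W_upto_swap_above W_upto_swap_both Us1 Us0 UJ3 UJ2 UJ1 UJ0 /LJ /Ls.
have := IH1 T Tr; have := IH2 T Tr; cbv zeta; rewrite -/r vE.
have := at_rank_diff_neq0 i1E pJ Tr k0 ik i1k; rewrite -/(v T).
move: (W J k T) (W (sw J) k T) (W J k (swap_level k r T)) (W (sw J) k (swap_level k r T)).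
move: (w T i) (w T i1) (v T i) (v T i1) (rho T) => y1 y2 x1 x2 ro f g fs gs x0 H2 H1.
(* The opposite direction: [J] and [sw J] trade places, so [D] becomes [- D] and the coefficients
   [cc] and 1 are exchanged. *)
have := @both_loc_exchange _ th thN th3 h x1 x2 y1 y2 B A g gs f fs 1 cc.
cbv zeta; rewrite BA opprK => /(_ B0 A0 ND0 x0 ccE' H2 H1) E.
transitivity (th (y1 - y2 + h) * (f * both_loc th h A B x1 x2 y2 y1 +
  fs * both_loc th h A B x2 x1 y2 y1) * ro); first by ring.
by rewrite E; ring.
Qed.

Lemma exchange_upto l : (b < l <= N)%N -> th D != 0 ->
  exchange_at l (W J l) (W (sw J) l) cc D /\
  exchange_at l (W (sw J) l) (W J l) 1 (- D).
Proof.
move=> /andP[bl lN] D0; elim: l bl lN => [//|l IH]; rewrite ltnS leq_eqVlt.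
case/orP => [/eqP <- _|bl lN]; first exact: exchange_base.
by apply: (@exchange_step (Ordinal lN)) => //; exact: IH (ltnW lN).
Qed.

End TwoBlocks.

End ExchangeTwoBlocks.

(** * The top level and the theorem *)

Section TopLevel.
Context {R : realType} {n N : nat}.
Variables (tau : R[i]) (lam : 'I_N -> nat) (h : R[i]) (mu : 'I_N -> R[i]).
Implicit Types (J : 'I_N -> {set 'I_n}) (t : nat -> nat -> R[i]) (z : 'I_n -> R[i]).

Lemma with_top_tperm (i i1 : 'I_n) t z : i1 = i.+1 :> nat ->
  with_top (N := N) t (z \o tperm i i1) = swap_level N i (with_top (N := N) t z).
Proof.
move=> i1E; apply/funext => k; apply/funext => a; rewrite /with_top /swap_level.
case: eqVneq => // _; rewrite eqxx; set w := if a == i then _ else _.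
have [an|an] := ltnP a n.
  have wn : (w < n)%N.
    by rewrite /w; case: ifP => _; [rewrite -i1E|case: ifP => _ //]; exact: ltn_ord.
  rewrite (insubT (fun x => x < n)%N wn) (insubT (fun x => x < n)%N an) /=.
  congr (z _); apply: val_inj; rewrite /= /w -i1E.
  case: tpermP => [/(congr1 val) /= ->|/(congr1 val) /= ->|/eqP + /eqP].
  - by rewrite eqxx.
  - by rewrite i1E (gtn_eqF (ltnSn i)) eqxx.
  by rewrite -!val_eqE /= => /negbTE -> /negbTE ->.
have -> : w = a.
  have := ltn_ord i; have := ltn_ord i1; rewrite i1E /w => h1 h2.
  by case: eqP => [|_]; [lia|case: eqP; lia].
by rewrite insubF //; apply/negbTE; rewrite -leqNgt.
Qed.

Lemma lev_top J : ordered_partition lam J -> lev J N = [set: 'I_n].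
Proof. by case=> _ _ <-; apply: eq_bigl => j; rewrite ltn_ord. Qed.

Lemma rank_setT (e : 'I_n) : rank [set: 'I_n] e = e.
Proof.
rewrite rank_index ?inE // enum_setT -enumT.
by rewrite index_enum_ord.
Qed.

Lemma W_regular_t J t z : W_regular tau lam J t h mu ->
  t_regular tau lam (with_top (N := N) t z).
Proof.
move=> [H _] k a b k0 ab; rewrite /with_top ltn_eqF //.
by apply: H; rewrite // eq_sym.
Qed.

Lemma W_regular_shift J t (k : 'I_N) e :
  ordered_partition lam J -> W_regular tau lam J t h mu ->
  (0 < k)%N -> e \in lev J k -> theta tau (shift_at h mu J k e) != 0.
Proof.
move=> pJ [_ H] k0 ek; have rk := rank_bound ek; rewrite (card_lev pJ) in rk.
by have := H k (Ordinal rk) k0; rewrite (psi_shiftE _ _ (elt_rank ek)).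
Qed.

End TopLevel.

(* For [s sigma : 'S_n], [(s * sigma)%g] is the permutation [x |-> sigma (s x)],
   i.e. the composition usually written [sigma s]. *)
Theorem theorem2p2 (R : realType) (n N : nat) (n_gt0 : (0 < n)%N)
    (N_gt0 : (0 < N)%N) (lam : 'I_N -> nat)
    (sum_lam : (\sum_(k < N) lam k)%N = n)
    (tau : R[i]) (Im_tau : 0 < complex.Im tau)
    (I : 'I_N -> {set 'I_n}) (partI : ordered_partition lam I)
    (i i1 : 'I_n) (i1E : i1 = i.+1 :> nat)
    (sigma : 'S_n) (a b : 'I_N)
    (sigma_i : sigma i \in I a) (sigma_i1 : sigma i1 \in I b)
    (t : nat -> nat -> R[i]) (z : 'I_n -> R[i]) (h : R[i])
    (mu : 'I_N -> R[i]) :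
  let sigma_s := (tperm i i1 * sigma)%g in
  let sI := perm_partition (tperm (sigma i) (sigma i1)) I in
  let x := z (sigma i) - z (sigma i1) in
  let mu_i := mu_shift (perm_partition sigma^-1%g I) i h mu in
  (a = b ->
     Wperm_regular tau lam sigma_s I t h mu ->
     Wperm_regular tau lam sigma I t h mu ->
     Wperm_ell tau lam sigma_s I t z h mu = Wperm_ell tau lam sigma I t z h mu)
  /\
  (a <> b ->
     Wperm_regular tau lam sigma_s I t h mu ->
     Wperm_regular tau lam sigma I t h mu ->
     Wperm_regular tau lam sigma sI t h mu ->
     R_regular tau a b h x mu_i ->
     Wperm_ell tau lam sigma_s I t z h mu =
       R_diag tau a b h x mu_i * Wperm_ell tau lam sigma I t z h mu +
       R_offdiag tau b a h x mu_i * Wperm_ell tau lam sigma sI t z h mu).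
Proof.
move=> sigma_s sI x mu_i.
pose J := perm_partition sigma^-1%g I; pose s := tperm i i1.
have pJ : ordered_partition lam J by exact: partition_perm.
have memJ j k : sigma j \in I k -> j \in J k.
  by move=> jk; rewrite -[j](permK sigma) imset_f.
have iJ := memJ _ _ sigma_i; have i1J := memJ _ _ sigma_i1.
have sigma_sE : perm_partition sigma_s^-1%g I = perm_partition s J.
  by rewrite /sigma_s invMg tpermV perm_partitionM.
(* Conjugating the transposition of [sigma i] and [sigma i1] by [sigma] gives [s]. Hence only the
   partitions [J] and [s (J)] occur in the claim. *)
have sIE : perm_partition sigma^-1%g sI = perm_partition s J.
  rewrite /sI -tpermJ -perm_partitionM /J -perm_partitionM; congr perm_partition.
  by rewrite conjgE -!mulgA mulgV mulg1.
have zE : z \o sigma_s = (z \o sigma) \o s.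
  by apply/funext => e; rewrite /= /sigma_s permM.
pose t' := with_top (N := N) t (z \o sigma).
have rankN : rank (lev J N) i = i by rewrite (lev_top pJ) rank_setT.
have topE : with_top (N := N) t (z \o sigma_s) = swap_level N (rank (lev J N) i) t'.
  by rewrite zE with_top_tperm // rankN.
have xE : t' N i - t' N i.+1 = x.
  rewrite /t' /with_top eqxx -i1E !valK; reflexivity.
rewrite /Wperm_ell /Wperm_regular sigma_sE sIE -/J !W_ell_upto // topE -/t'.
split=> [ab reg_s reg|ab reg_s reg _ [x0 D0 D0']].
  rewrite -ab in i1J.
  rewrite (sw_one_block pJ iJ i1J); congr (_ * _).
  apply: (W_upto_sym i1E Im_tau pJ iJ i1J).
  - by move=> k e; exact: W_regular_shift reg.
  - by rewrite ltn_ord leqnn.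
  exact: W_regular_t reg.
set E := theta tau h ^+ _.
have treg : t_regular tau lam t' by exact: W_regular_t reg.
have sreg k e := @W_regular_shift _ _ _ _ _ _ _ J t k e pJ reg.
have pJ' : ordered_partition lam (perm_partition s J) by exact: partition_perm.
have sreg' k e := @W_regular_shift _ _ _ _ _ _ _ _ t k e pJ' reg_s.
(* At the top level [theta (x + h)] is nonzero by [R_regular], so the relation with cleared
   denominator gives the claim. *)
apply: (mulfI x0).
pose M := mu_shift J i h mu.
have [alb|bla|/val_inj //] := ltngtP a b.
  have [+ _] := exchange_upto Im_tau i1E pJ iJ i1J alb sreg
     (l := N) (introT andP (conj (ltn_ord b) (leqnn N))) D0'.
  move=> /(_ t' treg); cbv zeta; rewrite rankN xE -/M => H.
  rewrite mulrCA H /R_diag /R_offdiag alb.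
  have -> : h + (M b - M a) = h + M b - M a by ring.
  have -> : h - (M b - M a) = h + M a - M b by ring.
  have -> : x + (M b - M a) = x + M b - M a by ring.
  have -> : - (M b - M a) = M a - M b by ring.
  by field; rewrite x0 D0 D0'.
(* For [b < a] the relations are applied to [s (J)], in which [i] lies in the smaller block [b]; the
   second one, with diagonal coefficient 1, is the claim since [s (s (J)) = J]. *)
have iJ' : i \in perm_partition s J b by rewrite /perm_partition mem_swap tpermL.
have i1J' : i1 \in perm_partition s J a by rewrite /perm_partition mem_swap tpermR.
have levE : lev (perm_partition s J) N = lev J N by rewrite (lev_top pJ) (lev_top pJ').
have swJ : perm_partition s (perm_partition s J) = J by exact: swK.
have M'E : mu_shift (perm_partition s J) i h mu = M by exact: mu_shift_swap.
have D0'' : theta tau (mu_shift (perm_partition s J) i h mu a -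
    mu_shift (perm_partition s J) i h mu b) != 0 by rewrite M'E.
have [_ +] := exchange_upto Im_tau i1E pJ' iJ' i1J' bla sreg'
   (l := N) (introT andP (conj (ltn_ord a) (leqnn N))) D0''.
move=> /(_ t' treg); cbv zeta; rewrite levE rankN xE swJ M'E => H.
rewrite mulrCA H /R_diag /R_offdiag ltnNge (ltnW bla) /=.
have -> : x - (M a - M b) = x + M b - M a by ring.
have -> : - (M a - M b) = M b - M a by ring.
by field; rewrite x0 D0'.
Qed.
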